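(* Let $m\ge 1$, let $X=\{x_0,x_1,\ldots,x_m\}$, and let $\mathcal{H}_f^{\circ}$ be the algebra of rooted circle trees described in the context, with the grading by degree, the disjoint-union product, and the coproduct $\Delta$ defined there. Then $\mathcal{H}_f^{\circ}$ is a connected graded commutative unital Hopf algebra.
   Context: Fix an integer $m\ge 1$, the alphabet $X=\{x_0,x_1,\ldots,x_m\}$, and a ground field $k$ of characteristic zero. A (decorated, bicolored) rooted circle tree (rct) $c^i$ consists of a root labelled by an index $i\in\{1,\ldots,m\}$ together with a finite, possibly empty, sequence of internal vertices $v_1<v_2<\cdots<v_k$ (totally ordered clockwise starting from the root), each internal vertex decorated by a letter of $X$. Thus $c^i$ is determined by the pair $(i,\eta)$ with $\eta=x_{l_1}\cdots x_{l_k}$ the word of decorations. Internal vertices decorated by $x_0$ are called white; those decorated by $x_j$, $j\ge1$, are called black. The degree is $\mathsf{deg}(c^i)=2\,(\#\text{white vertices})+(\#\text{black vertices})+1$. Let $\mathcal{H}_f^{\circ}$ be the commutative polynomial $k$-algebra freely generated by all rcts (product = disjoint union), with unit $\mathbf{1}$ (the empty forest) of degree $0$, and degree extended additively to monomials. An admissible subset of $c^i$ is a nonempty subset $J$ of its internal vertices whose minimal element (in the vertex order) is white. Given pairwise disjoint admissible subsets $J_1,\ldots,J_k$ of $c^i$ with minimal elements $w_1<\cdots<w_k$ and indices $n_1,\ldots,n_k\in\{1,\ldots,m\}$: - $(c^i/J_1\cup\cdots\cup J_k)_{n_1\cdots n_k}$ is the rct with root label $i$ whose internal vertices are the internal vertices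 of $c^i$ not in $J_1\cup\cdots\cup J_k$ together with $w_1,\ldots,w_k$, in the induced order, where $w_a$ is now decorated by $x_{n_a}$ (hence black) and all other vertices keep their decorations; - $c^{n_a}_{|J_a}$ is the rct with root label $n_a$ whose internal vertices are the elements of $J_a\setminus\{w_a\}$, in the induced order, with their decorations. The coproduct is defined on an rct $c^i$ by $$\Delta(c^i)=c^i\otimes\mathbf{1}+\mathbf{1}\otimes c^i+\sum_{\{J_1,\ldots,J_k\}}\ \sum_{n_1,\ldots,n_k=1}^{m}(c^i/J_1\cup\cdots\cup J_k)_{n_1\cdots n_k}\otimes c^{n_1}_{|J_1}\cdots c^{n_k}_{|J_k},$$ where the first sum runs over all nonempty sets $\{J_1,\ldots,J_k\}$ of pairwise disjoint admissible subsets of $c^i$ (an ''admissible extraction''); $\Delta$ is extended to $\mathcal{H}_f^{\circ}$ as an algebra morphism with $\Delta(\mathbf{1})=\mathbf{1}\otimes\mathbf{1}$, and the counit sends $\mathbf{1}\mapsto1$ and every rct to $0$. *)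

(* Defs.v *)
From HB Require Import structures.
From mathcomp Require Import all_boot all_order all_algebra.
From mathcomp Require Import generic_quotient ring_quotient boolp finmap.
From mathcomp.multinomials Require Import monalg.

Set Implicit Arguments.
Unset Strict Implicit.
Unset Printing Implicit Defensive.

Import GRing.Theory.

Local Open Scope ring_scope.
Local Open Scope quotient_scope.

Reserved Notation "U ⊗ V" (at level 40, left associativity).

(* -------------------------------------------------------------------------- *)

Section LinearFunctions.
Context (k : comNzRingType) (U V : lmodType k) (f : U -> V).
Hypothesis f_linear : linear f.

Fact linear_fun0 : f 0 = 0.
Proof.
by have := f_linear (-1) 0 0; rewrite scaler0 addr0 scaleN1r addNr.
Qed.

Fact linear_funD x y : f (x + y) = f x + f y.
Proof. by rewrite -[x in LHS]scale1r f_linear scale1r. Qed.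

Fact linear_funZ a x : f (a *: x) = a *: f x.
Proof. by rewrite -[a *: x]addr0 f_linear linear_fun0 addr0. Qed.

End LinearFunctions.

(* -------------------------------------------------------------------------- *)

HB.lock Definition linext (k : comNzRingType) (K : choiceType) (V : lmodType k)
    (h : K -> V) (x : {malg k[K]}) : V := \sum_(m <- msupp x) x@_m *: h m.

Section LinearExtension.
Context (k : comNzRingType) (K : choiceType) (V : lmodType k).
Implicit Types (h : K -> V) (x : {malg k[K]}).

Lemma linextEw (d : {fset K}) h x : (msupp x `<=` d)%fset ->
  linext h x = \sum_(m <- d) x@_m *: h m.
Proof.
move=> le; rewrite linext.unlock (big_fset_incl _ le) => //= m md.
by move/mcoeff_outdom => ->; rewrite scale0r.
Qed.

Lemma linextU h a m : linext h << a *g m >> = a *: h m.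
Proof. by rewrite (linextEw h msuppU_le) big_seq_fset1 mcoeffUU. Qed.

Lemma linext_linear h : linear (linext h).
Proof.
move=> a x y; pose d := (msupp (a *: x + y) `|` msupp x `|` msupp y)%fset.
have d1 : (msupp (a *: x + y)%R `<=` d)%fset.
  by rewrite /d -fsetUA fsubsetUl.
have d2 : (msupp x `<=` d)%fset.
  by rewrite /d fsubsetU // fsubsetUr.
have d3 : (msupp y `<=` d)%fset by rewrite /d fsubsetUr.
rewrite (linextEw h d1) (linextEw h d2) (linextEw h d3) scaler_sumr -big_split.
by apply: eq_bigr => m _ /=; rewrite mcoeffD mcoeffZ scalerDl scalerA.
Qed.

HB.instance Definition _ h :=
  GRing.isLinear.Build k {malg k[K]} V *:%R (linext h) (linext_linear h).

End LinearExtension.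

(* -------------------------------------------------------------------------- *)

Section Tensor.
Context (k : fieldType) (U V : lmodType k).

Local Notation free := {malg k[(U * V)%type]}.

Inductive tensor_null : free -> Prop :=
| tensor_null0 : tensor_null 0
| tensor_nullD x y : tensor_null x -> tensor_null y -> tensor_null (x + y)
| tensor_nullZ a x : tensor_null x -> tensor_null (a *: x)
| tensor_nullL a u u' v :
    tensor_null (<< (a *: u + u', v) >> - (a *: << (u, v) >> + << (u', v) >>))
| tensor_nullR a u v v' :
    tensor_null (<< (u, a *: v + v') >> - (a *: << (u, v) >> + << (u, v') >>)).

Definition tensor_nullb (x : free) : bool := `[< tensor_null x >].

Fact tensor_nullb_closed : zmod_closed tensor_nullb.
Proof.
split=> [|x y /asboolP hx /asboolP hy]; apply/asboolP.
  exact: tensor_null0.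
by apply: tensor_nullD => //; rewrite -scaleN1r; apply: tensor_nullZ.
Qed.

HB.instance Definition _ :=
  GRing.isZmodClosed.Build free tensor_nullb tensor_nullb_closed.

Definition tensor : Type :=
  Quotient.quot (GRing.ZmodClosed.clone free tensor_nullb _).

HB.instance Definition _ := GRing.Zmodule.on tensor.
HB.instance Definition _ := ZmodQuotient.on tensor.

End Tensor.

HB.lock Definition tensor_pi (k : fieldType) (U V : lmodType k)
    (x : {malg k[(U * V)%type]}) : tensor U V := \pi_(tensor U V) x.

Section TensorModule.
Context (k : fieldType) (U V : lmodType k).

Local Notation free := {malg k[(U * V)%type]}.
Local Notation tensor := (tensor U V).
Local Notation tensor_pi := (@tensor_pi k U V).

Lemma tensor_pi_repr (t : tensor) : tensor_pi (repr t) = t.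
Proof. by rewrite tensor_pi.unlock; exact: reprK. Qed.

Lemma tensor_piP (P : tensor -> Prop) : (forall x, P (tensor_pi x)) -> forall t, P t.
Proof. by move=> h t; rewrite -[t]tensor_pi_repr. Qed.

Lemma tensor_pi_eq (x y : free) :
  tensor_pi x = tensor_pi y <-> tensor_null (x - y).
Proof.
rewrite tensor_pi.unlock; split=> [/eqP|h]; last apply/eqP;
  rewrite -Quotient.idealrBE.
  by move/asboolP.
exact/asboolP.
Qed.

Fact tensor_pi_zmod_morphism : zmod_morphism tensor_pi.
Proof.
by move=> x y; rewrite tensor_pi.unlock; apply: (raddfB (\pi_tensor)).
Qed.

HB.instance Definition _ :=
  GRing.isZmodMorphism.Build free tensor tensor_pi tensor_pi_zmod_morphism.

Definition tensor_scale (a : k) (t : tensor) : tensor :=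
  tensor_pi (a *: repr t).

Lemma tensor_scale_pi a x : tensor_scale a (tensor_pi x) = tensor_pi (a *: x).
Proof.
apply/tensor_pi_eq; rewrite -scalerBr; apply: tensor_nullZ.
by apply/tensor_pi_eq; rewrite tensor_pi_repr.
Qed.

Fact tensor_scaleA a b t :
  tensor_scale a (tensor_scale b t) = tensor_scale (a * b) t.
Proof.
by elim/tensor_piP: t => x; rewrite (tensor_scale_pi b) !tensor_scale_pi scalerA.
Qed.

Fact tensor_scale1 : left_id 1 tensor_scale.
Proof. by elim/tensor_piP=> x; rewrite tensor_scale_pi scale1r. Qed.

Fact tensor_scaleDr : right_distributive tensor_scale +%R.
Proof.
move=> a; elim/tensor_piP=> x; elim/tensor_piP=> y.
by rewrite -raddfD /= !tensor_scale_pi scalerDr raddfD.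
Qed.

Fact tensor_scaleDl t : {morph tensor_scale^~ t : a b / a + b}.
Proof.
by elim/tensor_piP: t => x a b; rewrite !tensor_scale_pi scalerDl raddfD.
Qed.

HB.instance Definition _ := GRing.Zmodule_isLmodule.Build k tensor
  tensor_scaleA tensor_scale1 tensor_scaleDr tensor_scaleDl.

Fact tensor_pi_scalable : scalable tensor_pi.
Proof. by move=> a x; rewrite -tensor_scale_pi. Qed.

HB.instance Definition _ :=
  GRing.isScalable.Build k free tensor *:%R tensor_pi tensor_pi_scalable.

Fact tensor_pi_linear a x y :
  tensor_pi (a *: x + y) = a *: tensor_pi x + tensor_pi y.
Proof.
rewrite [LHS](raddfD tensor_pi); congr (_ + _); exact: tensor_pi_scalable.
Qed.

End TensorModule.

HB.lock Definition tens (k : fieldType) (U V : lmodType k) (u : U) (v : V) :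
  tensor U V := tensor_pi << (u, v) >>.

(* The factorization through [tensor] of a bilinear map [b]; it is meaningful
   only when [b] is bilinear. *)
HB.lock Definition tlift (k : fieldType) (U V W : lmodType k)
    (b : U -> V -> W) (t : tensor U V) : W :=
  linext (fun p : (U * V)%type => b p.1 p.2) (repr t).

Section PureTensors.
Context (k : fieldType) (U V : lmodType k).

Local Notation free := {malg k[(U * V)%type]}.
Local Notation tensor := (tensor U V).
Local Notation tens := (@tens k U V).
Local Notation tensor_pi := (@tensor_pi k U V).

Lemma tens_bilinear : bilinear_for *:%R *:%R tens.
Proof.
rewrite tens.unlock; split=> [v a u u'|u a v v'];
  rewrite [RHS](esym (tensor_pi_linear _ _ _)).
  by apply/tensor_pi_eq; exact: tensor_nullL.
by apply/tensor_pi_eq; exact: tensor_nullR.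
Qed.

Lemma tensZl a u v : tens (a *: u) v = a *: tens u v.
Proof. exact: (linear_funZ (tens_bilinear.1 v)). Qed.

Lemma tensor_ind (P : tensor -> Prop) :
  P 0 -> (forall s t, P s -> P t -> P (s + t)) -> (forall u v, P (tens u v)) ->
  forall t, P t.
Proof.
move=> P0 PD Pt; elim/tensor_piP=> x.
rewrite [x]monalgE raddf_sum; apply: big_ind => // -[u v] _ /=.
have -> : << x@_(u, v) *g (u, v) >> = x@_(u, v) *: << (u, v) >> :> free.
  by apply/malgP=> p; rewrite mcoeffZ !mcoeffU mulrnAr mulr1.
have -> : tensor_pi (x@_(u, v) *: << (u, v) >>) = tens (x@_(u, v) *: u) v.
  by rewrite tensZl tens.unlock; exact: tensor_pi_scalable.
exact: Pt.
Qed.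

Section Universal.
Context (W : lmodType k) (b : U -> V -> W).
Hypothesis b_bilinear : bilinear_for *:%R *:%R b.

Local Notation ext := (linext (fun p : (U * V)%type => b p.1 p.2)).

Lemma tlift_null x : tensor_null x -> ext x = 0.
Proof.
elim=> [|y z _ hy _ hz|a y _ hy|a u u' v|a u v v'].
- by rewrite raddf0.
- by rewrite raddfD /= hy hz addr0.
- by rewrite linearZ /= hy scaler0.
- rewrite raddfB /= linext_linear !linextU !scale1r /=.
  by rewrite b_bilinear.1 subrr.
- rewrite raddfB /= linext_linear !linextU !scale1r /=.
  by rewrite b_bilinear.2 subrr.
Qed.

Lemma tlift_pi x : tlift b (tensor_pi x) = ext x.
Proof.
apply/eqP; rewrite -subr_eq0 tlift.unlock -raddfB; apply/eqP; apply: tlift_null.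
by apply/tensor_pi_eq; rewrite tensor_pi_repr.
Qed.

Lemma tliftE u v : tlift b (tens u v) = b u v.
Proof. by rewrite tens.unlock tlift_pi linextU scale1r. Qed.

Lemma tlift_linear : linear (tlift b).
Proof.
move=> a; elim/tensor_piP=> x; elim/tensor_piP=> y; rewrite -tensor_pi_linear !tlift_pi.
exact: linearP.
Qed.

Lemma tlift_unique (f : {linear tensor -> W}) :
  (forall u v, f (tens u v) = b u v) -> f =1 tlift b.
Proof.
move=> fE; apply: tensor_ind => [|s t hs ht|u v]; last by rewrite tliftE.
- by rewrite raddf0 (linear_fun0 tlift_linear).
- by rewrite raddfD /= hs ht (linear_funD tlift_linear).
Qed.

End Universal.
End PureTensors.

Arguments tens {k U V} u%_R v%_R.

Notation "U ⊗ V" := (tensor U%type V%type) : type_scope.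
Notation "u ⊗ v" := (tens u v) : ring_scope.

(* -------------------------------------------------------------------------- *)

HB.lock Definition tmul (k : fieldType) (A B : algType k) (s t : A ⊗ B) : A ⊗ B :=
  tlift (fun a b => tlift (fun a' b' => (a * a') ⊗ (b * b')) t) s.

Section TensorAlgebra.
Context (k : fieldType) (A B : algType k).

Local Notation tmul := (@tmul k A B).

Fact tmul_inner (a : A) (b : B) :
  bilinear_for *:%R *:%R (fun (a' : A) (b' : B) => (a * a') ⊗ (b * b')).
Proof.
split=> [v c u u'|u c v v'] /=.
  by rewrite mulrDr -scalerAr (tens_bilinear _ _).1.
by rewrite mulrDr -scalerAr (tens_bilinear _ _).2.
Qed.

Fact tmul_outer (t : A ⊗ B) : bilinear_for *:%R *:%R
  (fun (a : A) (b : B) => tlift (fun a' b' => (a * a') ⊗ (b * b')) t).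
Proof.
split=> [v c u u'|u c v v'] /=; elim/tensor_ind: t => [|s t hs ht|x y].
- by rewrite !(linear_fun0 (tlift_linear (tmul_inner _ _))) scaler0 addr0.
- rewrite !(linear_funD (tlift_linear (tmul_inner _ _))) hs ht.
  by rewrite scalerDr addrACA.
- rewrite !(tliftE (tmul_inner _ _)) mulrDl -scalerAl.
  by rewrite (tens_bilinear _ _).1.
- by rewrite !(linear_fun0 (tlift_linear (tmul_inner _ _))) scaler0 addr0.
- rewrite !(linear_funD (tlift_linear (tmul_inner _ _))) hs ht.
  by rewrite scalerDr addrACA.
- rewrite !(tliftE (tmul_inner _ _)) mulrDl -scalerAl.
  by rewrite (tens_bilinear _ _).2.
Qed.

Lemma tmulE a b a' b' : tmul (a ⊗ b) (a' ⊗ b') = (a * a') ⊗ (b * b').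
Proof.
by rewrite tmul.unlock (tliftE (tmul_outer _)) (tliftE (tmul_inner _ _)).
Qed.

Fact tmulDl : left_distributive tmul +%R.
Proof.
by move=> s s' t; rewrite tmul.unlock (linear_funD (tlift_linear (tmul_outer t))).
Qed.

Fact tmulDr : right_distributive tmul +%R.
Proof.
move=> s t t'; rewrite tmul.unlock; elim/tensor_ind: s => [|s s' hs hs'|a b].
- by rewrite !(linear_fun0 (tlift_linear (tmul_outer _))) addr0.
- by rewrite !(linear_funD (tlift_linear (tmul_outer _))) hs hs' addrACA.
- by rewrite !(tliftE (tmul_outer _)) (linear_funD (tlift_linear (tmul_inner _ _))).
Qed.

Fact tmul0t : left_zero 0 tmul.
Proof.
by move=> t; rewrite tmul.unlock (linear_fun0 (tlift_linear (tmul_outer t))).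
Qed.

Fact tmult0 : right_zero 0 tmul.
Proof.
move=> t; have := tmulDr t 0 0; rewrite addr0 => /(congr1 (+%R^~ (- tmul t 0))).
by rewrite -addrA addrN addr0.
Qed.

Fact tmulA : associative tmul.
Proof.
elim/tensor_ind=> [|s s' hs hs'|a b] t u.
- by rewrite !tmul0t.
- by rewrite !tmulDl hs hs'.
elim/tensor_ind: t => [|t t' ht ht'|a' b'].
- by rewrite tmul0t !tmult0 tmul0t.
- by rewrite tmulDl !tmulDr tmulDl ht ht'.
elim/tensor_ind: u => [|u u' hu hu'|a'' b''].
- by rewrite !tmult0.
- by rewrite !tmulDr hu hu'.
- by rewrite !tmulE !mulrA.
Qed.

Fact tmul1t : left_id (1 ⊗ 1) tmul.
Proof.
elim/tensor_ind=> [|t t' ht ht'|a b]; first exact: tmult0.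
- by rewrite tmulDr ht ht'.
- by rewrite tmulE !mul1r.
Qed.

Fact tmult1 : right_id (1 ⊗ 1) tmul.
Proof.
elim/tensor_ind=> [|t t' ht ht'|a b]; first exact: tmul0t.
- by rewrite tmulDl ht ht'.
- by rewrite tmulE !mulr1.
Qed.

HB.instance Definition _ := GRing.Zmodule_isPzRing.Build (tensor A B)
  tmulA tmul1t tmult1 tmulDl tmulDr.

End TensorAlgebra.

(* -------------------------------------------------------------------------- *)

Section Hopf.
Context (k : fieldType) (A : algType k).

Definition tmap (U U' V V' : lmodType k)
    (f : {linear U -> U'}) (g : {linear V -> V'}) : U ⊗ V -> U' ⊗ V' :=
  tlift (fun u v => f u ⊗ g v).

Definition tassoc (U V W : lmodType k) : (U ⊗ V) ⊗ W -> U ⊗ (V ⊗ W) :=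
  tlift (fun s w => tlift (fun u v => u ⊗ (v ⊗ w)) s).

Definition tscall (V : lmodType k) : k^o ⊗ V -> V :=
  tlift (fun (a : k^o) v => (a : k) *: v).
Definition tscalr (V : lmodType k) : V ⊗ k^o -> V :=
  tlift (fun v (a : k^o) => (a : k) *: v).

Definition talgmul : A ⊗ A -> A := tlift (fun x y : A => x * y).

Definition lid : {linear A -> A} := idfun.

Record is_coalgebra (Delta : {linear A -> (A ⊗ A)%type}) (eps : {linear A -> k^o}) :
    Prop := IsCoalgebra {
  coassociative : forall x,
    tassoc (tmap Delta lid (Delta x)) = tmap lid Delta (Delta x);
  counit_left : forall x, tscall (tmap eps lid (Delta x)) = x;
  counit_right : forall x, tscalr (tmap lid eps (Delta x)) = x }.

Record is_bialgebra (Delta : {linear A -> (A ⊗ A)%type}) (eps : {linear A -> k^o}) :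
    Prop := IsBialgebra {
  bialgebra_coalgebra : is_coalgebra Delta eps;
  coproduct_morphism : monoid_morphism Delta;
  counit_morphism : monoid_morphism eps }.

Record is_antipode (Delta : {linear A -> (A ⊗ A)%type}) (eps : {linear A -> k^o})
    (S : {linear A -> A}) : Prop := IsAntipode {
  antipode_left : forall x, talgmul (tmap S lid (Delta x)) = eps x *: 1;
  antipode_right : forall x, talgmul (tmap lid S (Delta x)) = eps x *: 1 }.

Record is_graded_algebra (G : nat -> A -> Prop) : Prop := IsGradedAlgebra {
  grading_submod : forall n, G n 0 /\
    forall (a : k) x y, G n x -> G n y -> G n (a *: x + y);
  grading_span : forall x, exists N (f : nat -> A),
    (forall n, G n (f n)) /\ x = \sum_(0 <= n < N) f n;
  grading_direct : forall N (f : nat -> A), (forall n, G n (f n)) ->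
    \sum_(0 <= n < N) f n = 0 -> forall n, (n < N)%N -> f n = 0;
  grading_one : G 0 1;
  grading_mul : forall p q x y, G p x -> G q y -> G (p + q)%N (x * y) }.

Definition tensor_grading (G : nat -> A -> Prop) (n : nat) (t : A ⊗ A) : Prop :=
  exists s : seq (A * A),
    (forall x, x \in s -> exists p q, [/\ G p x.1, G q x.2 & (p + q)%N = n]) /\
    t = \sum_(x <- s) x.1 ⊗ x.2.

Record is_connected_graded_commutative_Hopf_algebra (G : nat -> A -> Prop)
    (Delta : {linear A -> (A ⊗ A)%type}) (eps : {linear A -> k^o}) : Prop :=
    IsConnectedGradedCommutativeHopfAlgebra {
  hopf_commutative : commutative (@GRing.mul A);
  hopf_bialgebra : is_bialgebra Delta eps;
  hopf_graded : is_graded_algebra G;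
  hopf_graded_coproduct : forall n x, G n x -> tensor_grading G n (Delta x);
  hopf_graded_counit : forall n x, G n x -> (0 < n)%N -> eps x = 0;
  hopf_antipode : exists2 S : {linear A -> A},
    is_antipode Delta eps S & forall n x, G n x -> G n (S x);
  hopf_connected : forall x, G 0 x <-> exists a : k, x = a *: 1 }.

End Hopf.

(* -------------------------------------------------------------------------- *)

Section CircleTree.
Context (m : nat).

(* The letter x_0 is [ord0]; the letters x_1, ..., x_m are the [black n], and
   the indices 1, ..., m are the elements of ['I_m]. *)
Definition letter : Type := 'I_m.+1.
Definition black (n : 'I_m) : letter := lift ord0 n.

(* (root label, word of the decorations clockwise from the root) *)
Definition rct : Type := ('I_m * seq 'I_m.+1)%type.
HB.instance Definition _ := Countable.on rct.

Implicit Types c : rct.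

Definition vertex c : finType := 'I_(size c.2).
Definition deco c (v : vertex c) : letter := tnth (in_tuple c.2) v.
Definition white c (v : vertex c) : bool := deco v == ord0.

Definition rct_deg c : nat :=
  (2 * #|[set v : vertex c | white v]|
   + #|[set v : vertex c | ~~ white v]| + 1)%N.

Definition is_min c (J : {set vertex c}) (v : vertex c) : bool :=
  (v \in J) && [forall u in J, (v <= u)%N].

Definition admissible c (J : {set vertex c}) : bool :=
  [exists v, is_min J v && white v].

Definition admissible_extraction c (P : {set {set vertex c}}) : bool :=
  [&& P != set0, [forall J in P, admissible J] & trivIset P].

Section Contraction.
Variables (c : rct) (P : {set {set vertex c}}).
Variable n : {ffun {J : {set vertex c} | J \in P} -> 'I_m}.

Definition kept (v : vertex c) : bool :=
  (v \notin cover P) || [exists J in P, is_min J v].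

(* At most one [J] in [P] is picked when [P] is an admissible extraction, since
   its members are then pairwise disjoint. *)
Definition new_deco (v : vertex c) : letter :=
  if [pick J : {J : {set vertex c} | J \in P} | is_min (val J) v] is Some J
  then black (n J) else deco v.

Definition contract : rct :=
  (c.1, [seq new_deco v | v <- enum (vertex c) & kept v]).

End Contraction.

Definition restrict c (J : {set vertex c}) (i : 'I_m) : rct :=
  (i, [seq deco v | v <- enum J & ~~ is_min J v]).

End CircleTree.

(* -------------------------------------------------------------------------- *)

Section CircleTreeAlgebra.
Context (k : fieldType) (m : nat).

Definition forest : conomType := {cmonom (rct m)}.
Definition Hcirc : comAlgType k := {malg k[forest]}.

Definition tree (c : rct m) : Hcirc := << ucm c >>.

(* The value on a monomial of the algebra morphism sending [tree c] to [phi c];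
   composing with [linext] gives its value on all of [Hcirc]. *)
Definition multext (R : pzSemiRingType) (phi : rct m -> R) (f : forest) : R :=
  \prod_(c <- finsupp f) phi c ^+ f c.

Definition rct_coproduct (c : rct m) : Hcirc ⊗ Hcirc :=
  tree c ⊗ 1 + 1 ⊗ tree c
  + \sum_(P : {set {set vertex c}} | admissible_extraction P)
      \sum_(n : {ffun {J : {set vertex c} | J \in P} -> 'I_m})
        tree (contract n) ⊗
          \prod_(J : {J : {set vertex c} | J \in P})
            tree (restrict (val J) (n J)).

Definition coproduct : {linear Hcirc -> (Hcirc ⊗ Hcirc)%type} :=
  linext (multext rct_coproduct).

Definition counit : {linear Hcirc -> k^o} :=
  linext (multext (fun _ : rct m => 0 : k^o)).

Lemma multextU (R : pzSemiRingType) (phi : rct m -> R) c :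
  multext phi (ucm c) = phi c.
Proof. by rewrite /multext mdomU big_seq_fset1 cmUU expr1. Qed.

Lemma coproduct_tree c : coproduct (tree c) = rct_coproduct c.
Proof. by rewrite /coproduct /= /tree linextU scale1r multextU. Qed.

Lemma counit_tree c : counit (tree c) = 0.
Proof. by rewrite /counit /= /tree linextU scale1r multextU. Qed.

Definition forest_deg (f : forest) : nat :=
  (\sum_(c <- finsupp f) f c * rct_deg c)%N.

Definition homogeneous (n : nat) (x : Hcirc) : Prop :=
  forall f, f \in msupp x -> forest_deg f = n.

End CircleTreeAlgebra.

(* Main.v *)
(* A character of the algebra of circle trees with values in a commutative ring
   [A] is a family [d_1, ..., d_m] of noncommutative series over [A], [d_i(w)]
   being the value on the tree [(i, w)].  Reading the word of a tree from its root
   shows that the sum over admissible extractions is the Fliess-type composition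
   [f o d], determined by [(f o d)(1) = f(1)] and
     [D_j (f o d) = D_j f o d]                                      (j >= 1)
     [D_0 (f o d) = D_0 f o d + sum_n (d_n shuffle (D_n f o d))],
   where [D_a] is the left shift by [x_a], a derivation of the shuffle product.
   Hence [- o d] is multiplicative for the shuffle product, and
   [(f o d) o e = f o (d * e)] for the convolution [(d * e)_n = e_n + d_n o e],
   which is therefore associative.  The equation [x_n = - d_n o x] can be solved by
   recursion on the length of words, so characters form a group.  Coassociativity
   is associativity for the three universal characters with values in the triple
   tensor product, and the antipode is the inverse of the identity character. *)

Require Import Defs.
From HB Require Import structures.
From mathcomp Require Import all_boot all_order all_algebra.
From mathcomp Require Import boolp finmap zify.
From mathcomp.multinomials Require Import monalg.

Set Implicit Arguments.
Unset Strict Implicit.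
Unset Printing Implicit Defensive.

Import GRing.Theory.

Local Open Scope ring_scope.

(** * Series and the shuffle product *)

Section Series.
Context (X : Type) (A : comPzRingType).

Definition series : Type := seq X -> A.

(** Series are functions, so the equality and choice structures required by the ring hierarchy are
    the classical ones. *)
HB.instance Definition _ := gen_eqMixin series.
HB.instance Definition _ := gen_choiceMixin series.

Implicit Types (f g h : series) (a : X) (w : seq X).

Lemma series_eqP f g : f =1 g -> f = g.
Proof. exact: funext. Qed.

Definition series_add f g : series := fun w => f w + g w.
Definition series_opp f : series := fun w => - f w.
Definition series_zero : series := fun=> 0.

Fact series_addA : associative series_add.
Proof. by move=> f g h; apply: series_eqP => w; apply: addrA. Qed.
Fact series_addC : commutative series_add.
Proof. by move=> f g; apply: series_eqP => w; apply: addrC. Qed.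
Fact series_add0 : left_id series_zero series_add.
Proof. by move=> f; apply: series_eqP => w; apply: add0r. Qed.
Fact series_addN : left_inverse series_zero series_opp series_add.
Proof. by move=> f; apply: series_eqP => w; apply: addNr. Qed.

HB.instance Definition _ := GRing.isZmodule.Build series
  series_addA series_addC series_add0 series_addN.

Lemma seriesD f g w : (f + g) w = f w + g w. Proof. by []. Qed.
Lemma seriesN f w : (- f) w = - f w. Proof. by []. Qed.
Lemma series0 w : (0 : series) w = 0. Proof. by []. Qed.

Lemma series_sum (I : Type) (r : seq I) (P : pred I) (F : I -> series) w :
  (\sum_(i <- r | P i) F i) w = \sum_(i <- r | P i) F i w.
Proof.
elim: r => [|i r IH]; first by rewrite !big_nil.
by rewrite !big_cons; case: (P i) => //; rewrite seriesD IH.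
Qed.

Definition shift a f : series := fun w => f (a :: w).

Fact shift_zmod_morphism a : zmod_morphism (shift a).
Proof. by []. Qed.
HB.instance Definition _ a :=
  GRing.isZmodMorphism.Build series series (shift a) (shift_zmod_morphism a).

Lemma series_ext f g :
  f [::] = g [::] -> (forall a, shift a f = shift a g) -> f = g.
Proof. by move=> h0 hS; apply: series_eqP => -[|a w] //; apply: (congr1 (@^~ w) (hS a)). Qed.

(** The Leibniz rule is taken as the definition, which makes every left shift a derivation. The
    usual description by complementary subwords is [seriesM_word_of]. *)
Fixpoint shuffle f g w : A :=
  if w is a :: w' then shuffle (shift a f) g w' + shuffle f (shift a g) w'
  else f [::] * g [::].

Definition series_one : series := fun w => (size w == 0)%:R.

Fact shuffleC f g : shuffle f g = shuffle g f.
Proof.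
apply: funext => w; elim: w f g => [|a w IH] f g /=; first exact: mulrC.
by rewrite addrC !(IH _ g) (IH f).
Qed.

Fact shuffleDl f g h w : shuffle (f + g) h w = shuffle f h w + shuffle g h w.
Proof.
elim: w f g h => [|a w IH] f g h /=; first exact: mulrDl.
by rewrite (raddfD (shift a)) !IH addrACA.
Qed.

Fact shuffle1 f w : shuffle series_one f w = f w.
Proof.
elim: w f => [|a w IH] f /=; first exact: mul1r.
have -> : shift a series_one = 0 by [].
(* There is no ring structure yet, so the vanishing comes from additivity by cancellation. *)
rewrite IH (_ : shuffle 0 f w = 0) ?add0r//.
by apply: (addrI (shuffle 0 f w)); rewrite -shuffleDl !addr0.
Qed.

(** Shifting either side by a letter gives the same three terms, one for each factor that receives
    the letter. *)
Fact shuffleA f g h w : shuffle f (shuffle g h) w = shuffle (shuffle f g) h w.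
Proof.
elim: w f g h => [|a w IH] f g h /=; first exact: mulrA.
have D u v : shift a (shuffle u v) =
    (shuffle (shift a u) v : series) + (shuffle u (shift a v) : series) by [].
rewrite !D [in RHS]shuffleDl [shuffle f (_ + _)]shuffleC shuffleDl.
by rewrite ![shuffle _ f]shuffleC !IH addrA.
Qed.

Definition series_mul f g : series := shuffle f g.

Fact series_mulA : associative series_mul.
Proof. by move=> f g h; apply: series_eqP => w; apply: shuffleA. Qed.
Fact series_mulC : commutative series_mul.
Proof. exact: shuffleC. Qed.
Fact series_mul1 : left_id series_one series_mul.
Proof. by move=> f; apply: series_eqP => w; apply: shuffle1. Qed.
Fact series_mulD : left_distributive series_mul +%R.
Proof. by move=> f g h; apply: series_eqP => w; apply: shuffleDl. Qed.

HB.instance Definition _ := GRing.Zmodule_isComPzRing.Build series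
  series_mulA series_mulC series_mul1 series_mulD.

Lemma seriesM0 f g : (f * g) [::] = f [::] * g [::]. Proof. by []. Qed.
Lemma shiftM a f g : shift a (f * g) = shift a f * g + f * shift a g.
Proof. by []. Qed.
Lemma seriesMS a w f g :
  (f * g) (a :: w) = (shift a f * g) w + (f * shift a g) w.
Proof. by []. Qed.
Lemma shift1 a : shift a 1 = 0. Proof. by []. Qed.
End Series.

(** * Composition of series and the group of characters *)

Section Composition.
Context (m : nat) (A : comPzRingType).

Local Notation word := (seq 'I_m.+1).
Local Notation ser := (series 'I_m.+1 A).

Implicit Types (d e : 'I_m -> ser) (u v f g : ser) (w : word).

(* Reads [w] from left to right: a letter is put on one of the circles already
   opened, whose series have shuffle product [u], or kept in [f]; a letter [x_0]
   may also be replaced by [x_n] while opening a new circle with series [d n]. *)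
Fixpoint comp_acc d u f w : A :=
  if w is a :: w' then
    comp_acc d (shift a u) f w' + comp_acc d u (shift a f) w' +
    (if a == ord0 then \sum_n comp_acc d (u * d n) (shift (black n) f) w' else 0)
  else u [::] * f [::].

Definition comp d f : ser := comp_acc d 1 f.

Lemma comp_accDl d u v f w :
  comp_acc d (u + v) f w = comp_acc d u f w + comp_acc d v f w.
Proof.
elim: w u v f => [|a w IH] u v f /=; first exact: mulrDl.
rewrite raddfD !IH; case: ifP => _; last by rewrite !addr0 addrACA.
rewrite [X in _ + X = _](_ : _ = \sum_n (comp_acc d (u * d n) (shift (black n) f) w
    + comp_acc d (v * d n) (shift (black n) f) w)); last first.
  by apply: eq_bigr => n _; rewrite mulrDl IH.
by rewrite big_split /= [X in X + _ = _]addrACA [LHS]addrACA.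
Qed.

Lemma comp_accDr d u f g w :
  comp_acc d u (f + g) w = comp_acc d u f w + comp_acc d u g w.
Proof.
elim: w u f g => [|a w IH] u f g /=; first exact: mulrDr.
rewrite raddfD !IH; case: ifP => _; last by rewrite !addr0 addrACA.
rewrite [X in _ + X = _](_ : _ = \sum_n (comp_acc d (u * d n) (shift (black n) f) w
    + comp_acc d (u * d n) (shift (black n) g) w)); last first.
  by apply: eq_bigr => n _; rewrite raddfD IH.
by rewrite big_split /= [X in X + _ = _]addrACA [LHS]addrACA.
Qed.

(** The recursion shifts the accumulator just as the Leibniz rule shifts one factor of a product,
    and its other branches only multiply it; so a factor of the accumulator can be pulled out. *)
Lemma comp_accM d u v f w : comp_acc d (v * u) f w = (v * (comp_acc d u f : ser)) w.
Proof.
elim: w u v f => [|a w IH] u v f /=; first by rewrite !seriesM0 /= mulrA.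
rewrite seriesMS shiftM comp_accDl !IH -addrA -!addrA; congr (_ + _).
have -> : shift a (comp_acc d u f : ser) = (comp_acc d (shift a u) f : ser) +
   (comp_acc d u (shift a f) : ser) +
   (if a == ord0 then \sum_n (comp_acc d (u * d n) (shift (black n) f) : ser) else 0).
  apply: series_eqP => w' /=; rewrite !seriesD; congr (_ + _).
  by case: ifP => _ //; rewrite series_sum.
rewrite !mulrDr !seriesD -addrA; congr (_ + (_ + _)).
case: ifP => _; last by rewrite mulr0.
by rewrite mulr_sumr series_sum; apply: eq_bigr => n _; rewrite -mulrA IH.
Qed.

Lemma comp_accE d u f w : comp_acc d u f w = (u * comp d f) w.
Proof. by rewrite -comp_accM mulr1. Qed.

Fact comp_zmod_morphism d : zmod_morphism (comp d).
Proof.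
move=> f g; apply: (addIr (comp d g)); rewrite subrK.
by apply: series_eqP => w; rewrite seriesD -comp_accDr subrK.
Qed.
HB.instance Definition _ d :=
  GRing.isZmodMorphism.Build ser ser (comp d) (comp_zmod_morphism d).

Lemma comp0 d f : comp d f [::] = f [::].
Proof. exact: mul1r. Qed.

(** These equations determine composition. With accumulator 1 the branch shifting the accumulator
    vanishes, and the series [d n] of a new circle comes out as a factor. *)
Lemma shift_comp d f a : shift a (comp d f) = comp d (shift a f) +
  (if a == ord0 then \sum_n d n * comp d (shift (black n) f) else 0).
Proof.
apply: series_eqP => w; rewrite /comp /shift /= shift1.
have -> : comp_acc d 0 f w = 0 by rewrite -[0](mul0r (0 : ser)) comp_accM mul0r.
rewrite add0r seriesD; congr (_ + _); case: ifP => // _.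
by rewrite series_sum; apply: eq_bigr => n _; rewrite mul1r comp_accE.
Qed.

Lemma shift_black_comp d f n : shift (black n) (comp d f) = comp d (shift (black n) f).
Proof. by rewrite shift_comp addr0. Qed.

(* The auxiliary factor [u] turns the derivative of the statement into instances
   of the statement itself, so that an induction on the word goes through. *)
Lemma compM d : {morph comp d : f g / f * g}.
Proof.
move=> f g; suff H w u : (u * comp d (f * g)) w = (u * (comp d f * comp d g)) w.
  by apply: series_eqP => w; have := H w 1; rewrite !mul1r.
elim: w u f g => [|a w IH] u f g; first by rewrite !seriesM0 !comp0.
rewrite !seriesMS IH; congr (_ + _).
rewrite shiftM !shift_comp shiftM raddfD !mulrDl !mulrDr !seriesD !IH.
rewrite addrACA; congr (_ + _).
case: ifP => _; last by rewrite !(mulr0, mul0r) !series0 addr0.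
rewrite mulr_suml !mulr_sumr !series_sum -big_split; apply: eq_bigr => n _ /=.
rewrite shiftM raddfD !mulrDr seriesD !(mulrA u (d n)) !IH.
by rewrite -!mulrA (mulrCA (comp d f)).
Qed.

(* A family [d] amounts to the character [(i, w) |-> d i w] of the algebra of
   circle trees, and [star] is the convolution product of characters. *)
Definition star d e : 'I_m -> ser := fun n => e n + comp e (d n).

(** At [x_0] the summands of [star d e n] match the two sources of new circles on the right:
    [comp e (d n)] is a circle opened by [d] and then composed with [e], while [e n] is a circle
    opened by [e], where the shift by [x_n] passes through [comp d]. The factor [u] serves as in
    [compM]. *)
Lemma comp_star d e f : comp (star d e) f = comp e (comp d f).
Proof.
suff H w u : (u * comp (star d e) f) w = (u * comp e (comp d f)) w.
  by apply: series_eqP => w; have := H w 1; rewrite !mul1r.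
elim: w u f => [|a w IH] u f; first by rewrite !seriesM0 !comp0.
rewrite !seriesMS IH; congr (_ + _).
rewrite !shift_comp raddfD !mulrDr !seriesD IH -addrA; congr (_ + _).
case: ifP => _; last by rewrite raddf0 mulr0 addr0.
rewrite raddf_sum !mulr_sumr !series_sum -big_split; apply: eq_bigr => n _ /=.
by rewrite compM shift_black_comp mulrA IH mulrDr mulrDl seriesD addrC !mulrA.
Qed.

Lemma star_assoc d e h : star d (star e h) = star (star d e) h.
Proof. by apply: funext => n; rewrite /star comp_star raddfD addrA. Qed.

Lemma comp_zero f : comp (fun=> 0) f = f.
Proof.
apply: series_eqP => w; elim: w f => [|a w IH] f; first exact: comp0.
rewrite -[LHS]/(shift a (comp (fun=> 0) f) w) shift_comp seriesD IH.
by case: ifP => _; rewrite ?big1 ?addr0// => n _; rewrite mul0r.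
Qed.

Lemma star0 d : star d (fun=> 0) = d.
Proof. by apply: funext => n; rewrite /star add0r comp_zero. Qed.

Lemma star0l d : star (fun=> 0) d = d.
Proof. by apply: funext => n; rewrite /star raddf0 addr0. Qed.

Lemma seriesM_local N u v f g : (forall w, (size w <= N)%N -> u w = v w) ->
  (forall w, (size w <= N)%N -> f w = g w) ->
  forall w, (size w <= N)%N -> (u * f) w = (v * g) w.
Proof.
move=> + + w; elim: w N u v f g => [|a w IH] N u v f g huv hfg; first by rewrite !seriesM0 huv ?hfg.
case: N huv hfg => // N huv hfg hw.
by rewrite !seriesMS; congr (_ + _); apply: (IH N) => // w' hw';
  first [exact: huv | exact: hfg | apply: huv; exact: leqW | apply: hfg; exact: leqW].
Qed.

(** Opening a circle consumes a letter, so [d] is only evaluated on words strictly shorter than [w].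
    This turns the fixed point equation of the inverse into a recursion on length. *)
Lemma comp_acc_local N d e u v f w :
  (forall n w', (size w' < N)%N -> d n w' = e n w') ->
  (forall w', (size w' <= N)%N -> u w' = v w') ->
  (size w <= N)%N -> comp_acc d u f w = comp_acc e v f w.
Proof.
elim: w N u v f => [|a w IH] N u v f hd huv /=; first by rewrite huv.
case: N hd huv => // N hd huv hw.
have hd' n w' : (size w' < N)%N -> d n w' = e n w'.
  by move=> h; apply: hd; rewrite ltnS ltnW.
have huv' w' : (size w' <= N)%N -> u w' = v w'.
  by move=> h; apply: huv; rewrite leqW.
rewrite (IH N _ (shift a v))//; last by move=> w' h; apply: huv.
rewrite (IH N _ v)//; congr (_ + _); case: ifP => // _; apply: eq_bigr => n _.
by apply: (IH N) => //; apply: seriesM_local => // w' h; apply: hd.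
Qed.

(* The fixed point equation [x = - comp x d] determines [x] on words of length
   [N] from its values on shorter words. *)
Fixpoint star_inv_iter d (N : nat) : 'I_m -> ser :=
  if N is N'.+1 then fun n => - comp (star_inv_iter d N') (d n) else fun=> 0.

Definition star_inv d : 'I_m -> ser := fun n w => star_inv_iter d (size w).+1 n w.

(** By locality each iteration settles words one letter longer; hence the index [(size w).+1] in
    [star_inv]. *)
Lemma star_inv_iter_stable d N n w :
  (size w < N)%N -> star_inv_iter d N n w = star_inv d n w.
Proof.
suff H N' M w' i : (size w' < N')%N -> (size w' < M)%N ->
    star_inv_iter d N' i w' = star_inv_iter d M i w'.
  by move=> h; apply: H.
elim: N' M w' i => [|N' IH] [|M] w' i //= h1 h2.
rewrite !seriesN; congr (- _); apply: (@comp_acc_local (size w')) => // j w'' h.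
by apply: IH; apply: leq_trans h _.
Qed.

Lemma star_invr d : star d (star_inv d) = fun=> 0.
Proof.
apply: funext => n; apply: series_eqP => w; rewrite /star seriesD.
rewrite {1}/star_inv /= seriesN addrC; apply/eqP; rewrite subr_eq0; apply/eqP.
apply: (@comp_acc_local (size w)) => // i w' h.
by rewrite star_inv_iter_stable.
Qed.

(** In a monoid where every element has a right inverse, right inverses are two-sided: [d] is the
    inverse of its inverse. *)
Lemma star_invl d : star (star_inv d) d = fun=> 0.
Proof.
have dE : d = star_inv (star_inv d).
  by rewrite -[RHS]star0l -(star_invr d) -star_assoc star_invr star0.
by rewrite {2}dE star_invr.
Qed.

End Composition.

(** * Naturality of composition in the coefficient ring *)

Section CompositionMorphism.
Context (m : nat) (A B : comPzRingType).

Local Notation serA := (series 'I_m.+1 A).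
Local Notation serB := (series 'I_m.+1 B).

Section RingMorphism.
Context (F : {rmorphism A -> B}).
Let map (f : serA) : serB := fun w => F (f w).

Fact map_seriesM (f g : serA) : map (f * g) = map f * map g.
Proof.
apply: series_eqP => w; elim: w f g => [|a w IH] f g; first exact: rmorphM.
by rewrite seriesMS -!IH -rmorphD.
Qed.

Fact map_series1 : map 1 = 1.
Proof. by apply: series_eqP => w; apply: rmorph_nat. Qed.

Lemma comp_acc_morph (d : 'I_m -> serA) (u f : serA) w :
  F (comp_acc d u f w) = comp_acc (fun n => map (d n)) (map u) (map f) w.
Proof.
elim: w u f => [|a w IH] u f /=; first exact: rmorphM.
rewrite !rmorphD !IH; congr (_ + _); case: ifP => _; last exact: rmorph0.
by rewrite rmorph_sum; apply: eq_bigr => n _; rewrite IH map_seriesM.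
Qed.

Lemma star_rmorph (d e : 'I_m -> serA) n w :
  F (star d e n w) = star (fun i => map (d i)) (fun i => map (e i)) n w.
Proof. by rewrite /star seriesD rmorphD comp_acc_morph map_series1. Qed.

End RingMorphism.

(** An unbundled form, for maps between tensor products that come only with proofs of additivity and
    multiplicativity. *)
Lemma star_morph (F : A -> B) (d e : 'I_m -> serA) n w :
  zmod_morphism F -> monoid_morphism F ->
  F (star d e n w) = star (fun i v => F (d i v)) (fun i v => F (e i v)) n w.
Proof.
move=> hz hm; pose Fr : {rmorphism A -> B} := HB.pack F
  (GRing.isZmodMorphism.Build _ _ F hz) (GRing.isMonoidMorphism.Build _ _ F hm).
exact: (star_rmorph Fr).
Qed.

End CompositionMorphism.

(** * Degrees under composition *)

Definition word_deg m (w : seq 'I_m.+1) : nat :=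
  \sum_(a <- w) (if a == ord0 then 2 else 1)%N.

Section CompositionGrading.
Context (m : nat) (A : comPzRingType) (Q : nat -> A -> Prop).
Hypothesis Q0 : forall n, Q n 0.
Hypothesis QD : forall n x y, Q n x -> Q n y -> Q n (x + y).
Hypothesis QN : forall n x, Q n x -> Q n (- x).
Hypothesis QM : forall p q x y, Q p x -> Q q y -> Q (p + q) (x * y).
Hypothesis Q1 : Q 0 1.

Local Notation ser := (series 'I_m.+1 A).

Let Q_eq n n' x : n = n' -> Q n x -> Q n' x.
Proof. by move=> ->. Qed.

(** [Q] will be the grading of the algebra or of its tensor square. The offset [p] counts what the
    word does not see; for the series of a character it is 1, the contribution of the root. *)
Definition graded_series (p : nat) (f : ser) : Prop :=
  forall w, Q (word_deg w + p) (f w).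

Lemma graded_shift p a f : graded_series p f ->
  graded_series ((if a == ord0 then 2 else 1)%N + p) (shift a f).
Proof.
by move=> h w; have := h (a :: w); rewrite /word_deg big_cons addnCA addnA.
Qed.

Lemma graded_seriesM p q f g : graded_series p f -> graded_series q g ->
  graded_series (p + q) (f * g).
Proof.
move=> + + w; elim: w p q f g => [|a w IH] p q f g hf hg.
  rewrite seriesM0 addnCA; rewrite /word_deg big_nil add0n.
  by apply: QM; [have := hf [::]|have := hg [::]]; rewrite /word_deg big_nil.
rewrite seriesMS /word_deg big_cons -/(word_deg w); apply: QD.
  by apply: Q_eq (IH _ _ _ _ (graded_shift a hf) hg); lia.
by apply: Q_eq (IH _ _ _ _ hf (graded_shift a hg)); lia.
Qed.

(** The weights balance when a circle is opened: [x_0], of weight 2, is replaced by a black letter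
    of weight 1 and the root of the new circle, also of weight 1. *)
Lemma graded_comp_acc d u f p q : (forall n, graded_series 1 (d n)) ->
  graded_series p u -> graded_series q f ->
  graded_series (p + q) (comp_acc d u f : ser).
Proof.
move=> hd + + w; elim: w p q u f => [|a w IH] p q u f hu hf /=.
  exact: (graded_seriesM hu hf [::]).
rewrite /word_deg big_cons -/(word_deg w); apply: QD; first apply: QD.
- by apply: Q_eq (IH _ _ _ _ (graded_shift a hu) hf); lia.
- by apply: Q_eq (IH _ _ _ _ hu (graded_shift a hf)); lia.
case: ifP => _; last exact: Q0.
apply: (big_ind (Q _)) => [||n _]; [exact: Q0|exact: QD|].
apply: Q_eq (IH _ _ _ _ (graded_seriesM hu (hd n)) (graded_shift (black n) hf)).
by rewrite /=; lia.
Qed.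

Lemma graded_comp d f p : (forall n, graded_series 1 (d n)) ->
  graded_series p f -> graded_series p (comp d f).
Proof.
move=> hd hf; apply: (@graded_comp_acc d 1 f 0) => // -[|a w].
  by rewrite /word_deg big_nil.
exact: Q0.
Qed.

Lemma graded_star d e : (forall n, graded_series 1 (d n)) ->
  (forall n, graded_series 1 (e n)) -> forall n, graded_series 1 (star d e n).
Proof. by move=> hd he n w; apply: QD; [exact: he | exact: graded_comp]. Qed.

Lemma graded_star_inv d : (forall n, graded_series 1 (d n)) ->
  forall n, graded_series 1 (star_inv d n).
Proof.
move=> hd n w; rewrite /star_inv; move: (size w).+1 => N.
elim: N n w => [|N IH] n w /=.
  exact: Q0.
by apply: QN; apply: graded_comp.
Qed.

End CompositionGrading.

(** * Sums over admissible extractions *)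

Section MinimalVertex.
Context (N : nat).
Implicit Types (J X S : {set 'I_N}) (u v : 'I_N).

(** Convertible to [is_min], but over a fixed ordinal, so that inductions can shrink the set of
    vertices without changing the tree. *)
Definition is_minimum X v : bool := (v \in X) && [forall u in X, (v <= u)%N].

Lemma is_minimumP X v :
  reflect (v \in X /\ forall u, u \in X -> (v <= u)%N) (is_minimum X v).
Proof.
apply: (iffP andP) => -[vX h]; split=> //; first by move=> u; apply: (forall_inP h).
exact/forall_inP.
Qed.

Lemma is_minimum_uniq X u v : is_minimum X u -> is_minimum X v -> u = v.
Proof.
move=> /is_minimumP[uX hu] /is_minimumP[vX hv].
by apply/val_inj/anti_leq; rewrite hu// hv.
Qed.

Lemma ex_minimum X : X != set0 -> exists v, is_minimum X v.
Proof.
case/set0Pn => x xX; case: (arg_minnP (fun v : 'I_N => nat_of_ord v) xX) => v vX h.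
by exists v; apply/is_minimumP; split.
Qed.

Lemma is_minimum_sub X J v : is_minimum X v -> J \subset X -> v \in J -> is_minimum J v.
Proof.
move=> /is_minimumP[_ h] JX vJ; apply/is_minimumP; split=> // u uJ.
exact/h/(subsetP JX).
Qed.

Lemma enum_setE X : enum X = [seq v <- enum 'I_N | v \in X].
Proof. by rewrite {1}/enum_mem -enumT; apply: eq_filter. Qed.

(** Both lists are strictly increasing and have the same elements. *)
Lemma enum_minimum X v : is_minimum X v -> enum X = v :: enum (X :\ v).
Proof.
move=> /is_minimumP[vX h].
pose r := [rel i j : 'I_N | (i < j)%N].
have rt : transitive r by move=> x y z; apply: ltn_trans.
have rE (Y : {set 'I_N}) : sorted r (enum Y).
  rewrite enum_setE; apply: sorted_filter => //.
  by rewrite -[r]/(relpre val ltn) -sorted_map val_enum_ord iota_ltn_sorted.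
apply: (irr_sorted_eq rt) => //; first by move=> x; rewrite /= ltnn.
  rewrite /= path_sortedE// rE andbT; apply/allP => u; rewrite mem_enum !inE.
  by case/andP=> uv uX; rewrite /= ltn_neqAle h// andbT eq_sym.
move=> u; rewrite in_cons !mem_enum !inE.
by case: eqP => // ->.
Qed.

Lemma enum_not_minimum X v : is_minimum X v ->
  [seq u <- enum X | ~~ is_minimum X u] = enum (X :\ v).
Proof.
move=> h; rewrite (enum_minimum h) /= h /=; apply/all_filterP/allP => u.
rewrite mem_enum !inE => /andP[uv _]; apply: contra uv => hu.
exact/eqP/is_minimum_uniq/h.
Qed.

Context (m : nat) (deco : 'I_N -> 'I_m.+1).

Definition word_of X : seq 'I_m.+1 := [seq deco v | v <- enum X].

Lemma word_of_minimum X v : is_minimum X v -> word_of X = deco v :: word_of (X :\ v).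
Proof. by move=> h; rewrite /word_of (enum_minimum h). Qed.

Lemma word_of0 : word_of set0 = [::].
Proof. by rewrite /word_of enum_set0. Qed.

Context (A : comPzRingType).
Local Notation ser := (series 'I_m.+1 A).

(** The hypothesis covers all subsets of [X :\ v], since opening a circle at the first vertex [v]
    removes an arbitrary set of later vertices with it. *)
Lemma set_min_ind (P : {set 'I_N} -> Prop) : P set0 ->
  (forall X v, is_minimum X v -> (forall Y : {set 'I_N}, Y \subset X :\ v -> P Y) -> P X) ->
  forall X, P X.
Proof.
move=> P0 PS X; move: {2}#|X| (leqnn #|X|) => n.
elim: n X => [|n IH] X; first by rewrite leqn0 cards_eq0 => /eqP->.
move=> hX; have [->//|/ex_minimum[v hv]] := eqVneq X set0.
apply: (PS _ _ hv) => Y YX; apply: IH; rewrite -ltnS.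
apply: leq_ltn_trans (subset_leq_card YX) _; apply: leq_trans hX.
by have /andP[vX _] := hv; rewrite [in X in (_ < X)%N](cardsD1 v) vX.
Qed.

(** The two terms of the Leibniz rule at the first letter correspond to the sets [S] containing the
    first vertex [v] and to those avoiding it. *)
Lemma seriesM_word_of (f g : ser) X :
  (f * g) (word_of X) =
  \sum_(S : {set 'I_N} | S \subset X) f (word_of S) * g (word_of (X :\: S)).
Proof.
elim/set_min_ind: X f g => [|X v hv IH] f g.
  rewrite word_of0 seriesM0 (big_pred1 set0) ?setD0 ?word_of0// => S.
  by rewrite subset0.
have [vX _] := is_minimumP _ _ hv.
rewrite (word_of_minimum hv) seriesMS (bigID (fun S : {set 'I_N} => v \in S)) /=.
congr (_ + _); rewrite IH//.
  rewrite [RHS](reindex_onto (fun S => v |: S) (fun S => S :\ v)) /=; last first.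
    by move=> S /andP[_ vS]; rewrite setD1K.
  apply: eq_big => S.
    rewrite subUset sub1set vX setU11 /= andbT; apply/idP/andP => [SX|[SX /eqP<-]].
      split; first by apply: subset_trans SX (subsetDl _ _).
      by rewrite setU1K//; apply/negP => /(subsetP SX); rewrite !inE eqxx.
    by apply: setSD; rewrite subUset sub1set vX.
  move=> SX; have vS : v \notin S by apply/negP => /(subsetP SX); rewrite !inE eqxx.
  have hvS : is_minimum (v |: S) v.
    apply: is_minimum_sub hv _ (setU11 _ _); rewrite subUset sub1set vX /=.
    by apply: subset_trans SX (subsetDl _ _).
  by rewrite (word_of_minimum hvS) setU1K// setDDl.
apply: eq_big => [S|S SX]; first by rewrite subsetD1.
have hvS : is_minimum (X :\: S) v.
  apply: is_minimum_sub hv (subsetDl _ _) _; rewrite inE vX andbT.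
  by apply/negP => /(subsetP SX); rewrite !inE eqxx.
by rewrite (word_of_minimum hvS) setDDl setUC -setDDl.
Qed.

End MinimalVertex.

(** * Recursive description of extractions *)

Section Extractions.
Context (N m : nat) (deco : 'I_N -> 'I_m.+1).
Implicit Types (J K X S : {set 'I_N}) (u v : 'I_N).

(* An extraction [{J_1, ..., J_k}] with indices [n_1, ..., n_k] is encoded as the
   finite partial function [J_a |-> n_a]. *)
Local Notation labelling := {ffun {set 'I_N} -> option 'I_m}.
Implicit Types (q : labelling) (n : 'I_m).

(** Relative to a set [X] of remaining vertices, for the recursion. The empty extraction is
    included; it accounts for the term [c ⊗ 1] of the coproduct. *)
Definition extraction X q : bool :=
  [forall J, q J ==>
     (J \subset X) && [exists v, is_minimum J v && (deco v == ord0)]] &&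
  [forall J, forall K, [&& q J, q K & J != K] ==> [disjoint J & K]].

Lemma extractionP X q : reflect
  [/\ forall J, q J -> J \subset X,
      forall J, q J -> exists2 v, is_minimum J v & deco v = ord0
    & forall J K u, q J -> q K -> u \in J -> u \in K -> J = K]
  (extraction X q).
Proof.
apply: (iffP andP) => [[/forallP h1 /forallP h2]|[h1 h2 h3]]; split.
- by move=> J qJ; have := h1 J; rewrite qJ => /andP[].
- move=> J qJ; have := h1 J; rewrite qJ => /andP[_ /existsP[v /andP[? /eqP ?]]].
  by exists v.
- move=> J K u qJ qK uJ uK; apply/eqP; have /forallP/(_ K) := h2 J.
  rewrite qJ qK /=; case: eqP => //= _ /disjointFr/(_ uJ).
  by rewrite uK.
- apply/forallP => J; apply/implyP => qJ; rewrite h1//=.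
  by have [v ? ?] := h2 _ qJ; apply/existsP; exists v; apply/andP; split=> //; apply/eqP.
apply/forallP => J; apply/forallP => K; apply/implyP => /and3P[qJ qK JK].
rewrite -setI_eq0; apply/eqP/setP => u; rewrite !inE; apply/andP => -[uJ uK].
by move/eqP: JK; apply; apply: h3 uJ uK.
Qed.

Definition kept_by q v : bool :=
  [forall J, q J ==> (v \notin J)] || [exists J, q J && is_minimum J v].

Definition deco_by q v : 'I_m.+1 :=
  if [pick J | q J && is_minimum J v] is Some J
  then if q J is Some n then black n else deco v
  else deco v.

Definition contract_by q X : seq 'I_m.+1 :=
  [seq deco_by q v | v <- enum X & kept_by q v].

Definition extend q J n : labelling := [ffun K => if K == J then Some n else q K].
Definition remove q J : labelling := [ffun K => if K == J then None else q K].

(** Disjointness from [J] confines the other circles to [X :\: J]; conversely [J] may be added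
    because its minimum [v] is white. The condition [q J == None] makes [q] recoverable from
    [extend q J n]. *)
Lemma extraction_extend X v J n q : is_minimum X v -> v \in J -> J \subset X ->
  deco v = ord0 -> extraction X (extend q J n) && (q J == None) = extraction (X :\: J) q.
Proof.
move=> hX vJ JX v0; apply/andP/extractionP => [[/extractionP[h1 h2 h3] /eqP qJ]|[h1 h2 h3]].
  have qE K : q K -> K != J by apply: contraTneq => ->; rewrite qJ.
  have eE K : q K -> extend q J n K by move=> qK; rewrite ffunE (negbTE (qE _ qK)).
  split=> [K qK|K qK|K L u qK qL].
  - rewrite subsetD h1 ?eE// -setI_eq0; apply/eqP/setP => u; rewrite !inE.
    apply/andP => -[uK uJ]; move/eqP: (qE _ qK); apply; apply: h3 uK uJ.
      exact: eE.
    by rewrite ffunE eqxx.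
  - exact/h2/eE.
  - by apply: h3; apply: eE.
have qJ : q J = None.
  case E: (q J) => [i|//]; have /h1/subsetP/(_ _ vJ) : q J by rewrite E.
  by rewrite inE vJ.
split; last by rewrite qJ.
have dJ K u : q K -> u \in J -> u \in K -> False.
  by move=> qK uJ uK; have /subsetP/(_ _ uK) := h1 K qK; rewrite inE uJ.
apply/extractionP; split=> [K|K|K L u]; rewrite !ffunE.
- by case: eqP => [->//|_ /h1]; rewrite subsetD => /andP[].
- case: eqP => [->|_ /h2//] _; exists v => //; exact: is_minimum_sub hX _ _.
case: eqP => [->|_]; case: eqP => [->|_] // hK hL uK uL; last exact: h3 uK uL.
- by case: (dJ L u).
- by case: (dJ K u).
Qed.

Lemma extraction_cons X v q : is_minimum X v ->
  extraction X q && ~~ [exists J, q J && (v \in J)] = extraction (X :\ v) q.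
Proof.
move=> hX; apply/andP/extractionP => [[/extractionP[h1 h2 h3] hv]|[h1 h2 h3]].
  split=> // J qJ; rewrite subsetD1 h1//=; apply: contra hv => vJ.
  by apply/existsP; exists J; rewrite qJ.
split; last first.
  by apply/existsP => -[J /andP[/h1]]; rewrite subsetD1 => /andP[_ /negbTE->].
by apply/extractionP; split=> // J /h1; rewrite subsetD1 => /andP[].
Qed.

Lemma deco_by_minimum q J v n : q J = Some n -> is_minimum J v ->
  (forall K, q K -> v \in K -> K = J) -> deco_by q v = black n.
Proof.
move=> qJ hJ h; rewrite /deco_by; case: pickP => [K /andP[qK /andP[vK _]]|/(_ J)].
  by rewrite (h K)// qJ.
by rewrite qJ hJ.
Qed.

Lemma deco_by_none q v : (forall J, q J -> v \notin J) -> deco_by q v = deco v.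
Proof.
move=> h; rewrite /deco_by; case: pickP => // J /andP[/h vJ /andP[]].
by rewrite (negbTE vJ).
Qed.

Lemma contract_by_cons X v q : is_minimum X v -> (forall J, q J -> v \notin J) ->
  contract_by q X = deco v :: contract_by q (X :\ v).
Proof.
move=> hX h; rewrite /contract_by (enum_minimum hX) /=.
have -> : kept_by q v by apply/orP; left; apply/forallP => J; apply/implyP/h.
by rewrite /= deco_by_none.
Qed.

(** Of the vertices of [J] only the minimum [v] survives; being first in [X], it gives the first
    letter, now [x_n]. *)
Lemma contract_by_extend X v J n q : is_minimum X v -> v \in J -> J \subset X ->
  extraction (X :\: J) q ->
  contract_by (extend q J n) X = black n :: contract_by q (X :\: J).
Proof.
move=> hX vJ JX /extractionP[h1 _ _].
have hJ := is_minimum_sub hX JX vJ.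
have dJ K u : q K -> u \in J -> u \in K -> False.
  by move=> qK uJ uK; have /subsetP/(_ _ uK) := h1 K qK; rewrite inE uJ.
have qJ K : q K -> K != J.
  by move=> qK; apply/eqP => KJ; apply: (dJ K v) => //; rewrite KJ.
have eJ : extend q J n J = Some n by rewrite ffunE eqxx.
have eK K : q K -> extend q J n K = q K by move=> /qJ; rewrite ffunE => /negbTE->.
rewrite /contract_by (enum_minimum hX) /=.
have -> : kept_by (extend q J n) v.
  by apply/orP; right; apply/existsP; exists J; rewrite eJ.
rewrite /= (deco_by_minimum eJ hJ); last first.
  by move=> K; rewrite ffunE; case: eqP => // _ qK /(dJ K v qK vJ).
congr (_ :: _); rewrite !enum_setE -[in LHS]filter_predI -[in RHS]filter_predI.
(* Vertices of [J] other than [v] are lost on both sides; away from [J] the extra circle changes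
   nothing. *)
have kE u : kept_by (extend q J n) u && (u \in X :\ v) = kept_by q u && (u \in X :\: J).
  rewrite !inE; case: (boolP (u \in J)) => uJ /=.
    rewrite andbF; apply/negP => /andP[/orP[/forallP/(_ J)|/existsP[K]]].
      by rewrite eJ uJ.
    rewrite ffunE; case: eqP => [-> /= hu|_ /andP[qK /andP[uK _]]]; last by case: (dJ K u).
    by rewrite (is_minimum_uniq hu hJ) eqxx.
  have -> : (u == v) = false by apply/eqP => uv; rewrite uv vJ in uJ.
  congr (_ && _); congr (_ || _).
    apply: eq_forallb => K; rewrite ffunE; case: eqP => // -> /=.
    by rewrite uJ implybT.
  apply: eq_existsb => K; rewrite ffunE; case: eqP => // -> /=.
  by rewrite /is_minimum (negbTE uJ) andbF.
rewrite (eq_filter (a2 := predI (kept_by q) (mem (X :\: J)))); last by move=> u; apply: kE.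
apply/eq_in_map => u; rewrite mem_filter => /andP[/andP[_ /=]].
rewrite inE => /andP[uJ _] _; rewrite /deco_by.
rewrite (eq_pick (Q := fun K => q K && is_minimum K u)); last first.
  move=> K; rewrite /= ffunE; case: eqP => // ->.
  by rewrite /is_minimum (negbTE uJ) !andbF.
by case: pickP => // K /andP[qK _]; rewrite eK.
Qed.

Context (A : comPzRingType).
Local Notation ser := (series 'I_m.+1 A).
Implicit Types (d : 'I_m -> ser) (f : ser).

Definition extracted_word J : seq 'I_m.+1 :=
  [seq deco u | u <- enum J & ~~ is_minimum J u].

(** Sets outside the domain of [q] contribute 1, so the product runs over an index type that does
    not depend on [q]. *)
Definition extraction_weight d q : A :=
  \prod_J (if q J is Some n then d n (extracted_word J) else 1).

Lemma extraction_weight_extend d q J n : q J = None ->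
  extraction_weight d (extend q J n) = d n (extracted_word J) * extraction_weight d q.
Proof.
move=> qJ; rewrite /extraction_weight (bigD1 J)//= [in RHS](bigD1 J)//= qJ mul1r.
rewrite ffunE eqxx; congr (_ * _); apply: eq_bigr => K /negbTE KJ.
by rewrite ffunE KJ.
Qed.

Definition extraction_sum d f X : A :=
  \sum_(q | extraction X q) f (contract_by q X) * extraction_weight d q.

Lemma extraction_sum_extend d f X v J n :
  is_minimum X v -> v \in J -> J \subset X -> deco v = ord0 ->
  \sum_(q | extraction X q && (q J == Some n)) f (contract_by q X) * extraction_weight d q
  = d n (word_of deco (J :\ v)) * extraction_sum d (shift (black n) f) (X :\: J).
Proof.
move=> hX vJ JX v0; rewrite (reindex_onto (fun q => extend q J n) (fun q => remove q J));
    last first.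
  move=> q /andP[_ /eqP qJ]; apply/ffunP => K; rewrite !ffunE.
  by case: eqP => // ->.
rewrite mulr_sumr; apply: eq_big => q.
  rewrite -(extraction_extend (v := v) n _ hX)// -andbA; congr (_ && _).
  rewrite ffunE !eqxx; apply/eqP/eqP => [/ffunP/(_ J)|qJ].
    by rewrite !ffunE eqxx => <-.
  by apply/ffunP => K; rewrite !ffunE; case: eqP => // ->.
move=> /andP[/andP[hq _] /eqP/ffunP/(_ J)]; rewrite !ffunE eqxx => qJ.
have := extraction_extend n q hX vJ JX v0; rewrite hq -qJ eqxx => /esym hq'.
rewrite (contract_by_extend _ hX)// extraction_weight_extend// mulrCA.
by rewrite /extracted_word (enum_not_minimum (is_minimum_sub hX JX vJ)).
Qed.

(** Extractions are sorted by the fate of the first vertex [v] of [X]. If no circle contains it, its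
    letter is read unchanged. Otherwise it is the minimum of a unique circle [J], hence white;
    summing over [J], its label and the extractions of [X :\: J] gives the extra term of
    [shift_comp]. *)
Lemma extraction_sumE d f X : extraction_sum d f X = comp d f (word_of deco X).
Proof.
elim/set_min_ind: X f => [|X v hX IH] f.
  (* Circles are nonempty, so only the empty extraction remains. *)
  rewrite word_of0 comp0 /extraction_sum (big_pred1 [ffun=> None]) => [|q]; last first.
    apply/extractionP/eqP => [[h1 h2 _]|->].
      apply/ffunP => J; rewrite ffunE; case E: (q J) => [i|//].
      have qJ : q J by rewrite E.
      have [v /andP[vJ _] _] := h2 J qJ; have := h1 J qJ.
      by rewrite subset0 => /eqP J0; rewrite J0 inE in vJ.
    by split=> J; rewrite ffunE.
  rewrite /contract_by enum_set0 /= /extraction_weight big1 ?mulr1// => J _.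
  by rewrite ffunE.
have [vX _] := is_minimumP _ _ hX.
rewrite (word_of_minimum _ hX) -[RHS]/(shift (deco v) (comp d f) _) shift_comp seriesD.
rewrite /extraction_sum (bigID (fun q => [exists J, q J && (v \in J)])) /= addrC.
congr (_ + _).
  rewrite -IH//; apply: eq_big => q; first exact: extraction_cons.
  case/andP => _ /existsPn h; rewrite (contract_by_cons hX)// => J qJ.
  by have := h J; rewrite qJ.
(* A black [v] lies in no circle, as it would be the minimum of that circle. *)
case: eqP => [v0|v0]; last first.
  rewrite big_pred0 => // q; apply/negP => /andP[/extractionP[h1 h2 _]].
  case/existsP => J /andP[qJ vJ]; have [u hu u0] := h2 J qJ.
  by apply: v0; rewrite (is_minimum_uniq (is_minimum_sub hX (h1 _ qJ) vJ) hu).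
(* The circle containing [v] and its label become summation indices. *)
transitivity (\sum_(J : {set 'I_N} | (v \in J) && (J \subset X)) \sum_n
    d n (word_of deco (J :\ v)) * extraction_sum d (shift (black n) f) (X :\: J)).
  transitivity (\sum_(q | extraction X q && [exists J, q J && (v \in J)])
     \sum_(J : {set 'I_N} | q J && (v \in J)) f (contract_by q X) * extraction_weight d q).
    apply: eq_bigr => q /andP[/extractionP[_ _ h3] /existsP[J /andP[qJ vJ]]].
    rewrite (big_pred1 J)// => K; apply/andP/eqP => [[qK vK]|->//].
    exact: h3 vK vJ.
  rewrite (exchange_big_dep (fun J : {set 'I_N} => (v \in J) && (J \subset X))) /=; last first.
    by move=> q J /andP[/extractionP[h1 _ _] _] /andP[/h1-> ->].
  apply: eq_bigr => J /andP[vJ JX].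
  transitivity (\sum_(q | extraction X q && q J) \sum_(n | q J == Some n)
      f (contract_by q X) * extraction_weight d q).
    apply: eq_big => q.
      rewrite vJ andbT -andbA; congr (_ && _); apply: andb_idl => qJ.
      by apply/existsP; exists J; rewrite qJ.
    case/andP=> /andP[_ _] /andP[qJ _]; case E: (q J) qJ => [i|//] _.
    by rewrite (big_pred1 i)// => j; rewrite /= eq_sym.
  rewrite (exchange_big_dep xpredT) //=; apply: eq_bigr => i _.
  rewrite -(extraction_sum_extend d f i hX vJ JX v0); apply: eq_bigl => q.
  by rewrite -andbA; congr (_ && _); apply: andb_idl => /eqP->.
rewrite exchange_big series_sum; apply: eq_bigr => n _ /=.
(* With [S] equal to [J] without [v], choosing [J] amounts to choosing one of the splittings over
   which the shuffle product sums. *)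
rewrite seriesM_word_of (reindex_onto (fun S => v |: S) (fun J => J :\ v)) /=; last first.
  by move=> J /andP[vJ _]; rewrite setD1K.
apply: eq_big => S.
  rewrite setU11 /= subUset sub1set vX subsetD1; congr (_ && _).
  apply/eqP/idP => [<-|/setU1K//]; by rewrite !inE eqxx.
case/andP=> _ /eqP SE; rewrite SE -setDDl IH//.
exact: subsetDl.
Qed.

End Extractions.

(** * Admissible extractions of a tree as labellings *)

Section ExtractionSum.
Context (m : nat) (A : comPzRingType) (c : rct m).

Local Notation V := 'I_(size c.2).
Local Notation labelling := {ffun {set V} -> option 'I_m}.
Implicit Types (P : {set {set vertex c}}) (J K : {set vertex c}) (q : labelling).

Definition extracted q : {set {set vertex c}} := [set J | q J].

Lemma extraction_setT q : extraction (@deco m c) setT q =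
  [forall J in extracted q, admissible J] && trivIset (extracted q).
Proof.
apply/extractionP/andP => [[_ h2 h3]|[/forall_inP h2 /trivIsetP h3]]; split.
- apply/forall_inP => J; rewrite inE => /h2[v hv v0].
  by apply/existsP; exists v; apply/andP; split=> //; apply/eqP.
- apply/trivIsetP => J K; rewrite !inE => qJ qK JK; rewrite -setI_eq0.
  apply/eqP/setP => u; rewrite !inE; apply/andP => -[uJ uK].
  by move/eqP: JK; apply; apply: h3 uJ uK.
- by move=> J _; apply: subsetT.
- move=> J qJ; have /existsP[v /andP[hv /eqP v0]] : admissible J by apply: h2; rewrite inE.
  by exists v.
move=> J K u qJ qK uJ uK; apply/eqP/contraT => JK.
by have := disjointFr (h3 J K _ _ JK) uJ; rewrite !inE uK => /(_ qJ qK).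
Qed.

Section Labelling.
Variables (P : {set {set vertex c}}).
Hypothesis P_extraction : [forall J in P, admissible J] && trivIset P.

Let P_disjoint J K (u : vertex c) : J \in P -> K \in P -> u \in J -> u \in K -> J = K.
Proof.
case/andP: P_extraction => _ /trivIsetP h JP KP uJ uK; apply/eqP/contraT => JK.
by have := disjointFr (h J K JP KP JK) uJ; rewrite uK.
Qed.

Definition labelling_of (n : {ffun {J | J \in P} -> 'I_m}) : labelling :=
  [ffun J => omap n (insub J)].

Variable n : {ffun {J | J \in P} -> 'I_m}.

Lemma labelling_ofE (J : {J | J \in P}) : labelling_of n (val J) = Some (n J).
Proof. by rewrite ffunE valK. Qed.

Lemma labelling_of_some J : labelling_of n J = (J \in P) :> bool.
Proof. by rewrite ffunE; case: insubP => [K -> _|/negbTE->]. Qed.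

Lemma contractE : contract n = (c.1, contract_by (@deco m c) (labelling_of n) setT).
Proof.
rewrite /contract /contract_by; congr (_, _).
have -> : enum [set: V] = enum (vertex c) by apply: eq_enum => v; rewrite !inE.
have kE : @kept _ c P =1 kept_by (labelling_of n).
  move=> v; rewrite /kept /kept_by; congr (_ || _).
    apply/idP/forallP => [/negP h J|h]; last first.
      apply/negP => /bigcupP[J JP vJ].
      by have := h J; rewrite labelling_of_some JP vJ.
    apply/implyP; rewrite labelling_of_some => JP; apply/negP => vJ.
    by apply: h; apply/bigcupP; exists J.
  by apply: eq_existsb => J; rewrite labelling_of_some.
rewrite (eq_filter kE).
apply: eq_map => v; rewrite /new_deco /deco_by.
case: pickP => [J hJ|h]; case: pickP => [K /andP[]|h'] //.
- rewrite labelling_of_some => KP hK.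
  (* Both choices pick a circle containing [v], and the circles are disjoint. *)
  have -> : K = val J.
    have /andP[vK _] := hK; have /andP[vJ _] := hJ.
    exact: (P_disjoint KP (valP J) vK vJ).
  by rewrite labelling_ofE.
- by have := h' (val J); rewrite labelling_of_some (valP J) [is_minimum _ _]hJ.
- rewrite labelling_of_some => KP hK.
  by have := h (exist _ K KP); rewrite [is_min _ _]hK.
Qed.

Lemma extraction_weightE (d : 'I_m -> series 'I_m.+1 A) :
  extraction_weight (@deco m c) d (labelling_of n) =
  \prod_(J : {J | J \in P}) d (restrict (val J) (n J)).1 (restrict (val J) (n J)).2.
Proof.
rewrite /extraction_weight (bigID (fun J => J \in P)) /= [X in _ * X]big1 ?mulr1; last first.
  by move=> J /negbTE JP; have := labelling_of_some J; rewrite JP; case: (labelling_of n J).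
rewrite big_sub; apply: eq_bigr => J _.
by rewrite labelling_ofE.
Qed.

End Labelling.

Lemma sum_labelling P (F : labelling -> A) :
  \sum_(n : {ffun {J | J \in P} -> 'I_m}) F (labelling_of n) =
  \sum_(q | extracted q == P) F q.
Proof.
(* The root label [c.1] serves as default index; it is never reached for [J] in [P], where [q] is
   defined. *)
rewrite [RHS](reindex_onto (@labelling_of P)
  (fun q => [ffun J : {J | J \in P} => odflt c.1 (q (val J))])) /=; last first.
  move=> q /eqP qP; apply/ffunP => J; rewrite !ffunE; case: insubP => [K JP KJ|].
    rewrite /= ffunE KJ; move: JP; rewrite -qP inE.
    by case: (q J).
  by rewrite -qP inE /=; case: (q J).
apply: eq_bigl => n; symmetry; apply/andP; split.
  by apply/eqP/setP => J; rewrite inE labelling_of_some.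
by apply/eqP/ffunP => J; rewrite ffunE labelling_ofE.
Qed.

(** By [extraction_sumE] the right side is [b c] plus a sum over all extractions, of which the empty
    one gives [a c]. Taking for [a] and [b] the embeddings into the two tensor factors yields the
    coproduct. *)
Lemma extraction_sum_star (a b : rct m -> A) :
  a c + b c + \sum_(P : {set {set vertex c}} | admissible_extraction P)
    \sum_(n : {ffun {J : {set vertex c} | J \in P} -> 'I_m}) a (contract n) *
      \prod_(J : {J : {set vertex c} | J \in P}) b (restrict (val J) (n J)) =
  star (fun i w => a (i, w)) (fun i w => b (i, w)) c.1 c.2.
Proof.
set d := fun i w => b (i, w); set f := (fun w => a (c.1, w)) : series 'I_m.+1 A.
have wT : word_of (@deco m c) setT = c.2.
  rewrite /word_of.
  have -> : enum [set: V] = enum (vertex c) by apply: eq_enum => v; rewrite !inE.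
  exact: (map_tnth_enum (in_tuple c.2)).
have cE : c = (c.1, c.2) by case: (c).
rewrite /star seriesD addrAC [LHS]addrC {1}cE; congr (_ + _).
rewrite -[X in comp _ _ X]wT -extraction_sumE -/f.
pose F q := f (contract_by (@deco m c) q setT) * extraction_weight (@deco m c) d q.
pose adm (P : {set {set vertex c}}) := [forall J in P, admissible J] && trivIset P.
transitivity (\sum_(P | adm P) \sum_(q | extracted q == P) F q); last first.
  rewrite /extraction_sum (partition_big extracted adm) /=; last first.
    by move=> q; rewrite extraction_setT.
  apply: eq_bigr => P hP; apply: eq_bigl => q; rewrite extraction_setT.
  by case: eqP => [->|]; rewrite ?[X in X && _]hP ?andbF.
rewrite [RHS](bigD1 set0) /=; last first.
  by apply/andP; split; [apply/forall_inP => J | apply/trivIsetP => J K]; rewrite inE.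
congr (_ + _).
  rewrite (big_pred1 [ffun=> None]) => [|q]; last first.
    apply/eqP/eqP => [/setP q0|->]; last by apply/setP => J; rewrite !inE ffunE.
    by apply/ffunP => J; rewrite ffunE; have := q0 J; rewrite !inE; case: (q J).
  rewrite /F /extraction_weight big1 ?mulr1; last by move=> J _; rewrite ffunE.
  rewrite [in LHS]cE /f -[in LHS]wT /contract_by; congr (a (_, _)).
  rewrite (eq_filter (a2 := xpredT)); last first.
    by move=> v; apply/orP; left; apply/forallP => J; rewrite ffunE.
  rewrite filter_predT; apply: eq_map => v.
  by rewrite deco_by_none// => J; rewrite ffunE.
apply: eq_big => P; first by rewrite /admissible_extraction andbC.
case/and3P => _ h1 h2; rewrite -sum_labelling; apply: eq_bigr => n _.
by rewrite /F contractE ?extraction_weightE ?h1//.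
Qed.

End ExtractionSum.

Lemma rct_degE (m : nat) (c : rct m) : rct_deg c = (word_deg c.2 + 1)%N.
Proof.
rewrite /rct_deg /word_deg; congr (_ + _)%N; rewrite (big_tnth _ _ c.2).
rewrite (bigID (@white m c)) /= -!sum1dep_card big_distrr /=.
congr (_ + _)%N; apply: eq_bigr => v; rewrite /white /deco.
  by move=> ->.
by move/negbTE ->.
Qed.

(** * Tensor products of algebras *)

Section TensorAlgebraTheory.
Context (k : fieldType) (A B : algType k).

Lemma tensM (a a' : A) (b b' : B) : (a ⊗ b) * (a' ⊗ b') = (a * a') ⊗ (b * b').
Proof. exact: tmulE. Qed.

Lemma tens11 : (1 : A) ⊗ (1 : B) = 1. Proof. by []. Qed.

Lemma tensor_monoid_morphism (R : pzRingType) (L : A ⊗ B -> R) :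
  zmod_morphism L -> L (1 ⊗ 1) = 1 ->
  (forall a b a' b', L ((a * a') ⊗ (b * b')) = L (a ⊗ b) * L (a' ⊗ b')) ->
  monoid_morphism L.
Proof.
move=> LB L1 LM; split=> // x y.
have L0 : L 0 = 0 by rewrite -(subrr 0) LB subrr.
have LD u v : L (u + v) = L u + L v.
  by apply: (addIr (- L v)); rewrite -LB !addrK.
elim/tensor_ind: x y => [|s t hs ht|a b] y; first by rewrite mul0r L0 mul0r.
  by rewrite mulrDl !LD hs ht mulrDl.
elim/tensor_ind: y => [|s t hs ht|a' b']; first by rewrite mulr0 L0 mulr0.
  by rewrite mulrDr !LD hs ht mulrDr.
by rewrite tensM LM.
Qed.

Lemma tensor_scalerAl (c : k) (x y : A ⊗ B) : c *: (x * y) = (c *: x) * y.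
Proof.
elim/tensor_ind: x y => [|s t hs ht|a b] y.
- by rewrite scaler0 !mul0r scaler0.
- by rewrite scalerDr !mulrDl scalerDr hs ht.
elim/tensor_ind: y => [|s t hs ht|a' b'].
- by rewrite !mulr0 scaler0.
- by rewrite !mulrDr scalerDr hs ht.
by rewrite -tensZl !tensM -scalerAl tensZl.
Qed.

End TensorAlgebraTheory.

Section TensorComAlgebra.
Context (k : fieldType) (A B : comAlgType k).

Fact tensor_mulC : commutative (@GRing.mul (A ⊗ B)%type).
Proof.
elim/tensor_ind=> [|s t hs ht|a b] y.
- by rewrite mul0r mulr0.
- by rewrite mulrDl mulrDr hs ht.
elim/tensor_ind: y => [|s t hs ht|a' b'].
- by rewrite mul0r mulr0.
- by rewrite mulrDl mulrDr hs ht.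
by rewrite !tensM mulrC (mulrC b).
Qed.

HB.instance Definition _ :=
  GRing.PzRing_hasCommutativeMul.Build (tensor A B) tensor_mulC.

End TensorComAlgebra.

Lemma monalgZU (k : comNzRingType) (K : choiceType) (a : k) (x : K) :
  << a *g x >> = a *: << x >> :> {malg k[K]}.
Proof. by apply/malgP => y; rewrite mcoeffZ !mcoeffU mulrnAr mulr1. Qed.

(** * Algebra morphisms determined by their values on trees *)

Section LinearExtensionAlgebra.
Context (k : fieldType) (m : nat).

Local Notation H := (Hcirc k m).
Local Notation forest := (forest m).

Lemma monalgUM (f g : forest) : (<< (mmul f g) >> : H) = << f >> * << g >>.
Proof. by rewrite malgM_def fgmulUU mulr1. Qed.

Lemma multext1 (R : pzSemiRingType) (phi : rct m -> R) : multext phi mone = 1.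
Proof. by rewrite /multext mdom1 big_seq_fset0. Qed.

Lemma multextEw (R : comPzSemiRingType) (phi : rct m -> R) (f : forest) (D : {fset rct m}) :
  (finsupp f `<=` D)%fset -> multext phi f = \prod_(c <- D) phi c ^+ f c.
Proof.
move=> fD; rewrite /multext (big_fset_incl _ fD)//= => c _.
by rewrite -cmE_eq0 => /eqP->.
Qed.

Lemma multextM (R : comPzSemiRingType) (phi : rct m -> R) (f g : forest) :
  multext phi (mmul f g) = multext phi f * multext phi g.
Proof.
have h1 : (finsupp f `<=` finsupp (mmul f g))%fset by rewrite mdomD fsubsetUl.
have h2 : (finsupp g `<=` finsupp (mmul f g))%fset by rewrite mdomD fsubsetUr.
rewrite (multextEw phi h1) (multextEw phi h2) -big_split /=.
by apply: eq_bigr => c _; rewrite cmM exprD.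
Qed.

Lemma forest_ind (P : forest -> Prop) :
  P mone -> (forall c f, P f -> P (mmul (ucm c) f)) -> forall f, P f.
Proof.
move=> P1 PM f; move: {2}(mdeg f) (erefl (mdeg f)) => n.
elim: n f => [|n IH] f fn; first by rewrite (mdeg_eq0I fn).
have [f0|[c cf]] := fset_0Vmem (finsupp f).
  by move: fn; rewrite mdegE f0 big_seq_fset0.
have fE : f = mmul (ucm c) (divcm f (ucm c)).
  apply/eqP/cmP => i; rewrite cmM divcmE cmU.
  case: eqP => [<-|_]; last by rewrite subn0.
  by rewrite add1n subn1 prednK// lt0n cmE_neq0.
rewrite fE; apply: PM; apply: IH.
by move: fn; rewrite {1}fE mdegM mdegU add1n => -[].
Qed.

Lemma Hcirc_lin_ind (P : H -> Prop) :
  P 0 -> (forall a x y, P x -> P y -> P (a *: x + y)) -> (forall f, P << f >>) ->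
  forall x, P x.
Proof.
move=> P0 PZ PU x; rewrite [x]monalgE; elim/big_ind: _ => [//|y z hy hz|f _].
  by rewrite -[y]scale1r; apply: PZ.
rewrite monalgZU -[X in P X]addr0; apply: PZ; last exact: P0.
exact: PU.
Qed.

Lemma Hcirc_ind (P : H -> Prop) :
  P 0 -> (forall a x y, P x -> P y -> P (a *: x + y)) -> P 1 ->
  (forall c x, P x -> P (tree k c * x)) -> forall x, P x.
Proof.
move=> P0 PZ P1 PM; apply: (Hcirc_lin_ind P0 PZ) => f.
elim/forest_ind: f => [|c f hf]; first exact: P1.
by rewrite monalgUM; apply: PM.
Qed.

Section Extension.
Context (R : comAlgType k) (phi : rct m -> R).
Let F : {linear H -> R} := linext (multext phi).

Let FU f : F << f >> = multext phi f.
Proof. by rewrite /F /= linextU scale1r. Qed.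

Lemma linext_multext_monoid : monoid_morphism F.
Proof.
split=> [|x y]; first by rewrite -(multext1 phi); apply: FU.
elim/Hcirc_lin_ind: x y => [|a x x' hx hx'|f] y.
- by rewrite mul0r !raddf0 mul0r.
- rewrite mulrDl -scalerAl [in LHS]linearP [in RHS]linearP [in RHS]mulrDl -[in RHS]scalerAl.
  by congr (_ *: _ + _); [apply: hx | apply: hx'].
elim/Hcirc_lin_ind: y => [|a y y' hy hy'|g].
- by rewrite mulr0 !raddf0 mulr0.
- rewrite mulrDr -scalerAr [in LHS]linearP [in RHS]linearP [in RHS]mulrDr -[in RHS]scalerAr.
  by congr (_ *: _ + _); [apply: hy | apply: hy'].
apply: etrans (congr1 F (esym (monalgUM f g))) _.
apply: etrans (FU (mmul f g)) (etrans (multextM phi f g) _).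
exact: (congr2 *%R (esym (FU f)) (esym (FU g))).
Qed.

Lemma linext_multext_tree c : F (tree k c) = phi c.
Proof. by rewrite FU multextU. Qed.

End Extension.

End LinearExtensionAlgebra.

Section TensorNonTrivial.
Context (k : fieldType) (A B : comAlgType k).
Hypothesis tensor1_neq0 : (1 : A ⊗ B) != 0.

(* [tensor] itself only carries a possibly zero ring structure. *)
Definition tensor_nz : Type := tensor A B.
HB.instance Definition _ := GRing.ComPzRing.copy tensor_nz (tensor A B).
HB.instance Definition _ := GRing.Lmodule.copy tensor_nz (tensor A B).
HB.instance Definition _ := GRing.PzSemiRing_isNonZero.Build tensor_nz tensor1_neq0.
HB.instance Definition _ :=
  GRing.Lmodule_isLalgebra.Build k tensor_nz (@tensor_scalerAl k A B).
HB.instance Definition _ := GRing.Lalgebra_isComAlgebra.Build k tensor_nz.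

Definition tensor_comAlg : comAlgType k := tensor_nz.

End TensorNonTrivial.

Section Tmap.
Context (k : fieldType) (U U' V V' : lmodType k).
Context (f : {linear U -> U'}) (g : {linear V -> V'}).

Fact tmap_bilinear : bilinear_for *:%R *:%R (fun u v => f u ⊗ g v).
Proof.
split=> [v a u u'|u a v v'] /=; rewrite linearP.
  by rewrite (tens_bilinear _ _).1.
by rewrite (tens_bilinear _ _).2.
Qed.

Lemma tmapE u v : tmap f g (u ⊗ v) = f u ⊗ g v.
Proof. exact: (tliftE tmap_bilinear). Qed.

Lemma tmap_linear : linear (tmap f g).
Proof. exact: (tlift_linear tmap_bilinear). Qed.

End Tmap.

Section Tassoc.
Context (k : fieldType) (U V W : lmodType k).

Fact tassoc_inner (w : W) : bilinear_for *:%R *:%R (fun (u : U) (v : V) => u ⊗ (v ⊗ w)).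
Proof.
split=> [v a u u'|u a v v'] /=; first by rewrite (tens_bilinear _ _).1.
by rewrite (tens_bilinear _ _).1 (tens_bilinear _ _).2.
Qed.

Fact tassoc_outer : bilinear_for *:%R *:%R
  (fun s (w : W) => tlift (fun (u : U) (v : V) => u ⊗ (v ⊗ w)) s).
Proof.
split=> [w a s s'|s a w w'] /=; first by rewrite (tlift_linear (tassoc_inner w)).
elim/tensor_ind: s => [|s t hs ht|u v].
- by rewrite !(linear_fun0 (tlift_linear (tassoc_inner _))) scaler0 addr0.
- by rewrite !(linear_funD (tlift_linear (tassoc_inner _))) hs ht scalerDr addrACA.
- by rewrite !(tliftE (tassoc_inner _)) !(tens_bilinear _ _).2.
Qed.

Lemma tassocE (u : U) (v : V) (w : W) : tassoc ((u ⊗ v) ⊗ w) = u ⊗ (v ⊗ w).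
Proof. by rewrite /tassoc (tliftE tassoc_outer) (tliftE (tassoc_inner w)). Qed.

Lemma tassoc_linear : linear (@tassoc k U V W).
Proof. exact: (tlift_linear tassoc_outer). Qed.

End Tassoc.

Section UnitTensors.
Context (k : fieldType) (V : lmodType k).

Fact tscall_bilinear :
  bilinear_for *:%R *:%R (fun (a : k^o) (v : V) => (a : k) *: v).
Proof.
split=> [w c b b'|b c w w'] /=; first by rewrite scalerDl scalerA.
by rewrite scalerDr !scalerA mulrC.
Qed.

Fact tscalr_bilinear :
  bilinear_for *:%R *:%R (fun (v : V) (a : k^o) => (a : k) *: v).
Proof.
split=> [b c w w'|w c b b'] /=; first by rewrite scalerDr !scalerA mulrC.
by rewrite scalerDl scalerA.
Qed.

Lemma tscallE (a : k^o) (v : V) : tscall (a ⊗ v) = (a : k) *: v.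
Proof. exact: (tliftE tscall_bilinear). Qed.

Lemma tscalrE (v : V) (a : k^o) : tscalr (v ⊗ a) = (a : k) *: v.
Proof. exact: (tliftE tscalr_bilinear). Qed.

Lemma tscall_linear : linear (@tscall k V).
Proof. exact: (tlift_linear tscall_bilinear). Qed.

Lemma tscalr_linear : linear (@tscalr k V).
Proof. exact: (tlift_linear tscalr_bilinear). Qed.

End UnitTensors.

(** Turns a term of the convolution of the two embeddings into a term of the formula defining the
    coproduct. *)
Lemma tens_mul_prod (k : fieldType) (A B : comAlgType k) (I : finType) (a : A) (F : I -> B) :
  (a ⊗ (1 : B)) * \prod_i ((1 : A) ⊗ F i) = a ⊗ \prod_i F i.
Proof.
have tensr : {morph (fun b : B => (1 : A) ⊗ b) : x y / x * y}.
  by move=> x y; rewrite tensM mulr1.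
by rewrite -(big_morph _ tensr (tens11 _ _)) tensM mulr1 mul1r.
Qed.

(** * The Hopf algebra structure *)

Section CircleTreeHopf.
Context (k : fieldType) (m : nat) (H : comAlgType k) (t : rct m -> H).
(** The algebra is kept abstract: it is only known to be generated by the [t c], and the
    multiplicative maps [Delta] and [eps] only through their values on these. *)
Hypothesis H_ind : forall P : H -> Prop,
  P 0 -> (forall a x y, P x -> P y -> P (a *: x + y)) -> P 1 ->
  (forall c x, P x -> P (t c * x)) -> forall x, P x.
Context (Delta : {linear H -> (H ⊗ H)%type}) (eps : {linear H -> k^o}).
Hypothesis Delta_monoid : monoid_morphism Delta.
Hypothesis Delta_t : forall c, Delta (t c) =
  star (fun i w => t (i, w) ⊗ 1) (fun i w => 1 ⊗ t (i, w)) c.1 c.2.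
Hypothesis eps_monoid : monoid_morphism eps.
Hypothesis eps_t : forall c, eps (t c) = 0.

Section Convolution.
Context (R : comPzRingType) (s : k -> R -> R).
Context (L : H ⊗ H -> R) (f g : H -> R).
Hypothesis L_zmod : zmod_morphism L.
Hypothesis L_scale : forall a x, L (a *: x) = s a (L x).
Hypotheses (f_monoid : monoid_morphism f) (g_monoid : monoid_morphism g).
Hypothesis LE : forall u v, L (u ⊗ v) = f u * g v.

Lemma convolution_monoid : monoid_morphism L.
Proof.
case: f_monoid g_monoid => f1 fM [g1 gM].
apply: tensor_monoid_morphism => //; first by rewrite LE f1 g1 mulr1.
by move=> a b a' b'; rewrite !LE fM gM mulrACA.
Qed.

(** The morphism [L] carries the two embeddings of trees to [f] and [g], and [star] is natural; so
    convolution of morphisms is [star] of their families. *)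
Lemma convolution_tree c : L (Delta (t c)) =
  star (fun i w => f (t (i, w))) (fun i w => g (t (i, w))) c.1 c.2.
Proof.
rewrite Delta_t (star_morph _ _ _ _ L_zmod convolution_monoid).
congr (star _ _ _ _); apply: funext => i; apply: funext => w; rewrite LE.
  by rewrite g_monoid.1 mulr1.
by rewrite f_monoid.1 mul1r.
Qed.

(** Two algebra morphisms are compared on generators. The scalar action [s] is a bare function
    because the triple tensor product is used with separate ring and module structures. *)
Lemma convolution_eq (E : H -> R) : zmod_morphism E -> monoid_morphism E ->
  (forall a x, E (a *: x) = s a (E x)) ->
  (forall c, E (t c) =
    star (fun i w => f (t (i, w))) (fun i w => g (t (i, w))) c.1 c.2) ->
  forall x, L (Delta x) = E x.
Proof.
move=> EB [E1 EM] EZ Et; have [L1 LM] := convolution_monoid.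
have L0 : L 0 = 0 by rewrite -(subrr 0) L_zmod subrr.
have E0 : E 0 = 0 by rewrite -(subrr 0) EB subrr.
have LD u v : L (u + v) = L u + L v by apply: (addIr (- L v)); rewrite -L_zmod !addrK.
have ED u v : E (u + v) = E u + E v by apply: (addIr (- E v)); rewrite -EB !addrK.
apply: H_ind => [|a x y hx hy||c x hx].
- by rewrite linear0 L0 E0.
- by rewrite linearP LD ED L_scale EZ hx hy.
- by rewrite Delta_monoid.1 L1 E1.
by rewrite Delta_monoid.2 LM EM hx Et convolution_tree.
Qed.

End Convolution.

Lemma linear_zmod (U V : lmodType k) (F : U -> V) : linear F -> zmod_morphism F.
Proof.
by move=> FL x y; rewrite addrC -scaleN1r FL scaleN1r addrC.
Qed.

Lemma eps_tens_bilinear :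
  bilinear_for *:%R *:%R (fun u v : H => (eps u * eps v : k^o)).
Proof.
split=> [v a u u'|u a v v'] /=; rewrite linearP.
  by rewrite mulrDl -scalerAl.
by rewrite mulrDr -scalerAr.
Qed.

(** The counit tensored with itself sends 1 to 1. *)
Lemma tensor_neq0 : (1 : H ⊗ H) != 0.
Proof.
apply/eqP => /(congr1 (tlift (fun u v : H => (eps u * eps v : k^o)))).
rewrite -tens11 (tliftE eps_tens_bilinear) (linear_fun0 (tlift_linear eps_tens_bilinear)).
by rewrite eps_monoid.1 mulr1 => /eqP; rewrite oner_eq0.
Qed.

Local Notation H2 := (tensor_comAlg tensor_neq0).
Local Notation H3 := (H ⊗ H2)%type.

Lemma tens_unit_monoid : monoid_morphism (fun x : H => x ⊗ (1 : H2) : H3).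
Proof. by split=> // x y; rewrite tensM mulr1. Qed.

Lemma unit_tens_monoid : monoid_morphism (fun x : H2 => (1 : H) ⊗ x : H3).
Proof. by split=> // x y; rewrite tensM mulr1. Qed.

Lemma tens_linear_r (U V : lmodType k) (u : U) : linear (fun v : V => u ⊗ v).
Proof. exact: (tens_bilinear _ _).2. Qed.

Lemma tens_linear_l (U V : lmodType k) (v : V) : linear (fun u : U => u ⊗ v).
Proof. exact: (tens_bilinear _ _).1. Qed.

(** The embedding of the first two factors into the triple tensor product; [tassoc_mul] combines it
    with that of the third. *)
Definition tassoc_unit (x : H ⊗ H) : H3 := tassoc (x ⊗ (1 : H)).

Lemma tassoc_unit_linear : linear tassoc_unit.
Proof.
move=> a x y; rewrite /tassoc_unit (tens_linear_l (U := (H ⊗ H)%type) (1 : H) a x y).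
exact: tassoc_linear.
Qed.

Lemma tassoc_unitE u v : tassoc_unit (u ⊗ v) = u ⊗ (v ⊗ 1).
Proof. exact: tassocE. Qed.

Lemma tassoc_unit_monoid : monoid_morphism tassoc_unit.
Proof.
apply: tensor_monoid_morphism; first exact: linear_zmod tassoc_unit_linear.
  by rewrite tassoc_unitE.
move=> a b a' b'; rewrite !tassoc_unitE tensM; congr (_ ⊗ _).
by rewrite [RHS]tensM mulr1.
Qed.

Lemma tassoc_mul x v : tassoc (x ⊗ v) = tassoc_unit x * ((1 : H) ⊗ ((1 : H) ⊗ v : H2)) :> H3.
Proof.
have L (v' : H) := tens_linear_l (U := (H ⊗ H)%type) v'.
elim/tensor_ind: x => [|x y hx hy|a b].
- rewrite (linear_fun0 (L _)) (linear_fun0 (@tassoc_linear _ _ _ _)).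
  by rewrite (linear_fun0 tassoc_unit_linear) mul0r.
- rewrite (linear_funD (L _)) (linear_funD (@tassoc_linear _ _ _ _)) hx hy.
  by rewrite (linear_funD tassoc_unit_linear) mulrDl.
rewrite tassocE tassoc_unitE tensM mulr1; congr (_ ⊗ _).
by rewrite [RHS]tensM mul1r mulr1.
Qed.

Lemma coassociativity x :
  tassoc (tmap Delta (lid H) (Delta x)) = tmap (lid H) Delta (Delta x).
Proof.
pose L1 (x : H ⊗ H) : H3 := tassoc (tmap Delta (lid H) x).
pose L2 (x : H ⊗ H) : H3 := tmap (lid H) Delta x.
have L1L : linear L1.
  move=> a u v; rewrite /L1 (tmap_linear Delta (lid H) a u v).
  exact: tassoc_linear.
have L2L : linear L2 by exact: (tmap_linear (lid H) Delta).
(* On pure tensors each side is a product of two algebra morphisms, the characters to be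
   convolved. *)
pose f1 u : H3 := tassoc_unit (Delta u).
pose g1 v : H3 := (1 : H) ⊗ ((1 : H) ⊗ v : H2).
pose f2 u : H3 := u ⊗ (1 : H2).
pose g2 v : H3 := (1 : H) ⊗ (Delta v : H2).
have f1M : monoid_morphism f1.
  split=> [|u v]; first by rewrite /f1 Delta_monoid.1 tassoc_unit_monoid.1.
  by rewrite /f1 Delta_monoid.2 tassoc_unit_monoid.2.
have g1M : monoid_morphism g1.
  split=> // u v; rewrite /g1 tensM mulr1; congr (_ ⊗ _).
  by rewrite [RHS]tensM mulr1.
have f2M : monoid_morphism f2 by exact: tens_unit_monoid.
have g2M : monoid_morphism g2.
  split=> [|u v]; first by rewrite /g2 Delta_monoid.1.
  by rewrite /g2 Delta_monoid.2 [RHS]tensM mulr1.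
have L1E u v : L1 (u ⊗ v) = f1 u * g1 v.
  by rewrite /L1 tmapE; apply: tassoc_mul.
have L2E u v : L2 (u ⊗ v) = f2 u * g2 v.
  rewrite /L2 tmapE [RHS]tensM mulr1; congr (_ ⊗ _).
  by rewrite mul1r.
have L2M := convolution_monoid (linear_zmod L2L) f2M g2M L2E.
suff key : forall x, L1 (Delta x) = L2 (Delta x) by exact: key.
apply: (@convolution_eq H3 (fun a (x : H3) => a *: x) L1 f1 g1 _ _ f1M g1M L1E
  (fun x => L2 (Delta x))).
- exact: linear_zmod.
- by move=> a y; rewrite (linear_funZ L1L).
- by move=> y z; rewrite (raddfB Delta) (linear_zmod L2L).
- split=> [|y z]; first by rewrite Delta_monoid.1 L2M.1.
  by rewrite Delta_monoid.2 L2M.2.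
- by move=> a y; rewrite linearZ (linear_funZ L2L).
move=> c; rewrite (convolution_tree (linear_zmod L2L) f2M g2M L2E).
(* These embed trees into the three tensor factors. The left side becomes [star (star a b) e] and
   the right side [star a (star b e)]. *)
pose a : 'I_m -> series 'I_m.+1 H3 := fun i w => t (i, w) ⊗ (1 : H2).
pose b : 'I_m -> series 'I_m.+1 H3 := fun i w => (1 : H) ⊗ (t (i, w) ⊗ (1 : H) : H2).
pose e : 'I_m -> series 'I_m.+1 H3 := fun i w => (1 : H) ⊗ ((1 : H) ⊗ t (i, w) : H2).
have -> : (fun i w => f1 (t (i, w))) = star a b.
  apply: funext => i; apply: funext => w; rewrite /f1 Delta_t.
  rewrite (star_morph _ _ _ _ (linear_zmod tassoc_unit_linear) tassoc_unit_monoid) /=.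
  by congr (star _ _ _ _); apply: funext => j; apply: funext => v; rewrite tassoc_unitE.
have -> : (fun i w => g2 (t (i, w))) = star b e.
  apply: funext => i; apply: funext => w; rewrite /g2 Delta_t.
  exact: (star_morph _ _ _ _ (linear_zmod (tens_linear_r (V := H2) (1 : H))) unit_tens_monoid).
exact: (congr1 (fun F : 'I_m -> series 'I_m.+1 H3 => F c.1 c.2) (star_assoc a b e)).
Qed.

(** The counit vanishes on trees, so its family is zero, the unit of [star]. *)
Lemma left_counit x : tscall (tmap eps (lid H) (Delta x)) = x.
Proof.
pose L (y : H ⊗ H) : H := tscall (tmap eps (lid H) y).
have LL : linear L by move=> a u v; rewrite /L tmap_linear tscall_linear.
have fM : monoid_morphism (fun u => (eps u : k)%:A : H).
  split=> [|u v]; first by rewrite eps_monoid.1 scale1r.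
  by rewrite eps_monoid.2 -scalerAl mul1r scalerA.
apply: (@convolution_eq H (fun a (x : H) => a *: x) L (fun u => (eps u : k)%:A) id
  _ _ fM _ _ id).
- exact: linear_zmod.
- by move=> a y; rewrite (linear_funZ LL).
- by [].
- by move=> u v; rewrite /L tmapE tscallE -scalerAl mul1r.
- by [].
- by [].
- by [].
move=> c; have -> : (fun i w => (eps (t (i, w)) : k)%:A) = (fun=> 0) :> ('I_m -> series 'I_m.+1 H).
  by apply: funext => i; apply: funext => w; rewrite eps_t scale0r.
by rewrite star0l; case: c.
Qed.

Lemma right_counit x : tscalr (tmap (lid H) eps (Delta x)) = x.
Proof.
pose L (y : H ⊗ H) : H := tscalr (tmap (lid H) eps y).
have LL : linear L.
  by move=> a u v; rewrite /L tmap_linear tscalr_linear.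
have gM : monoid_morphism (fun u => (eps u : k)%:A : H).
  split=> [|u v]; first by rewrite eps_monoid.1 scale1r.
  by rewrite eps_monoid.2 -scalerAl mul1r scalerA.
apply: (@convolution_eq H (fun a (x : H) => a *: x) L id (fun u => (eps u : k)%:A)
  _ _ _ gM _ id).
- exact: linear_zmod.
- by move=> a y; rewrite (linear_funZ LL).
- by [].
- by move=> u v; rewrite /L tmapE tscalrE -scalerAr mulr1.
- by [].
- by [].
- by [].
move=> c; have -> : (fun i w => (eps (t (i, w)) : k)%:A) = (fun=> 0) :> ('I_m -> series 'I_m.+1 H).
  by apply: funext => i; apply: funext => w; rewrite eps_t scale0r.
by rewrite star0; case: c.
Qed.

Lemma coalgebra_circle_tree : is_coalgebra Delta eps.
Proof. by split; [exact: coassociativity|exact: left_counit|exact: right_counit]. Qed.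

Section Antipode.
Context (S : {linear H -> H}).
Hypothesis S_monoid : monoid_morphism S.
Hypothesis S_t : forall c, S (t c) = star_inv (fun i w => t (i, w)) c.1 c.2.

Lemma talgmul_bilinear : bilinear_for *:%R *:%R (fun x y : H => x * y).
Proof.
split=> [v a u u'|u a v v'] /=; first by rewrite mulrDl -scalerAl.
by rewrite mulrDr -scalerAr.
Qed.

(** The map [x |-> eps x *: 1] is the character with zero family, so inverse characters convolve to
    it. *)
Lemma convolution_unit (f g : {linear H -> H}) :
  monoid_morphism f -> monoid_morphism g ->
  (star (fun i w => f (t (i, w))) (fun i w => g (t (i, w))) = fun=> (0 : series 'I_m.+1 H)) ->
  forall x, talgmul (tmap f g (Delta x)) = eps x *: 1.
Proof.
move=> fM gM fg; pose L (y : H ⊗ H) : H := talgmul (tmap f g y).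
have LL : linear L.
  by move=> a u v; rewrite /L tmap_linear /talgmul (tlift_linear talgmul_bilinear).
apply: (@convolution_eq H (fun a (x : H) => a *: x) L f g _ _ fM gM _
  (fun x => (eps x : k) *: 1)).
- exact: linear_zmod.
- by move=> a y; rewrite (linear_funZ LL).
- by move=> u v; rewrite /L tmapE /talgmul (tliftE talgmul_bilinear).
- by move=> u v; rewrite raddfB scalerBl.
- split=> [|u v]; first by rewrite eps_monoid.1 scale1r.
  by rewrite eps_monoid.2 -scalerAl mul1r scalerA.
- by move=> a y; rewrite linearZ scalerA.
by move=> c; rewrite fg eps_t scale0r.
Qed.

Lemma antipode_circle_tree : is_antipode Delta eps S.
Proof.
have SE : (fun i w => S (t (i, w))) = star_inv (fun i w => t (i, w)).
  by apply: funext => i; apply: funext => w; rewrite S_t.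
split; apply: convolution_unit => //; rewrite SE.
  exact: star_invl.
exact: star_invr.
Qed.

End Antipode.

(** * Grading and connectedness *)

Section Grading.
Context (G : nat -> H -> Prop).
Hypothesis G_graded : is_graded_algebra G.
Hypothesis G_t : forall c, G (rct_deg c) (t c).
Hypothesis G_ind : forall P : nat -> H -> Prop,
  (forall n, P n 0) -> (forall n a x y, P n x -> P n y -> P n (a *: x + y)) ->
  P 0 1 -> (forall c n x, P n x -> P (rct_deg c + n)%N (t c * x)) ->
  forall n x, G n x -> P n x.

Let G0 n : G n 0. Proof. by case: (grading_submod G_graded n). Qed.
Let GZ n a x y : G n x -> G n y -> G n (a *: x + y).
Proof. by case: (grading_submod G_graded n) => _; apply. Qed.
Let GD n x y : G n x -> G n y -> G n (x + y).
Proof. by move=> hx hy; rewrite -[x]scale1r; apply: GZ. Qed.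
Let GN n x : G n x -> G n (- x).
Proof. by move=> hx; rewrite -scaleN1r -[_ *: _]addr0; apply: GZ. Qed.
Let G1 := grading_one G_graded.
Let GM p q x y : G p x -> G q y -> G (p + q) (x * y).
Proof. exact: (grading_mul G_graded). Qed.

Local Notation tG := (tensor_grading G).

Lemma tensor_grading0 n : tG n 0.
Proof. by exists [::]; split=> //; rewrite big_nil. Qed.

Lemma tensor_gradingD n x y : tG n x -> tG n y -> tG n (x + y).
Proof.
move=> [s [hs ->]] [s' [hs' ->]]; exists (s ++ s'); rewrite big_cat; split=> // z.
by rewrite mem_cat => /orP[/hs|/hs'].
Qed.

Lemma tensor_grading_tens p q u v : G p u -> G q v -> tG (p + q) (u ⊗ v).
Proof.
move=> hu hv; exists [:: (u, v)]; rewrite big_seq1; split=> // z.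
by rewrite inE => /eqP ->; exists p, q.
Qed.

Lemma tensor_grading_sum n (I : eqType) (r : seq I) (F : I -> H ⊗ H) :
  (forall i, i \in r -> tG n (F i)) -> tG n (\sum_(i <- r) F i).
Proof.
move=> h; rewrite big_seq; elim/big_ind: _ => //; first exact: tensor_grading0.
exact: tensor_gradingD.
Qed.

Lemma tensor_gradingZ n a x : tG n x -> tG n (a *: x).
Proof.
move=> [s [hs ->]]; rewrite scaler_sumr; apply: tensor_grading_sum => z /hs[p [q [hp hq <-]]].
by rewrite -tensZl; apply: tensor_grading_tens => //; rewrite -[_ *: _]addr0; apply: GZ.
Qed.

Lemma tensor_gradingM n n' x y : tG n x -> tG n' y -> tG (n + n') (x * y).
Proof.
move=> [s [hs ->]] [s' [hs' ->]]; rewrite mulr_suml.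
apply: tensor_grading_sum => z /hs[p [q [hp hq <-]]]; rewrite mulr_sumr.
apply: tensor_grading_sum => z' /hs'[p' [q' [hp' hq' <-]]]; rewrite tensM addnACA.
by apply: tensor_grading_tens; apply: GM.
Qed.

Lemma tensor_grading1 : tG 0 1.
Proof. by rewrite -tens11; apply: (@tensor_grading_tens 0 0). Qed.

Lemma Delta_graded n x : G n x -> tG n (Delta x).
Proof.
move: n x; apply: G_ind => [n|n a x y hx hy||c n x hx].
- by rewrite linear0; apply: tensor_grading0.
- by rewrite linearP; apply/tensor_gradingD => //; apply: tensor_gradingZ.
- by rewrite Delta_monoid.1; apply: tensor_grading1.
rewrite Delta_monoid.2 Delta_t; apply: tensor_gradingM hx; rewrite rct_degE.
apply: (graded_star tensor_grading0 tensor_gradingD tensor_gradingM tensor_grading1).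
  (* The offset 1 is the root of the tree, whichever tensor factor carries it. *)
  move=> i w; rewrite -[X in tG X]addn0 -(rct_degE (i, w)).
  exact: tensor_grading_tens.
move=> i w; rewrite -[X in tG X]add0n -(rct_degE (i, w)).
exact: tensor_grading_tens.
Qed.

Lemma eps_graded n x : G n x -> (0 < n)%N -> eps x = 0.
Proof.
move: n x; apply: G_ind => [n|n a x y hx hy||c n x hx] // hn.
- by rewrite linear0.
- by rewrite linearP hx// hy// scaler0 addr0.
by rewrite eps_monoid.2 eps_t mul0r.
Qed.

Lemma antipode_graded (S : {linear H -> H}) : monoid_morphism S ->
  (forall c, S (t c) = star_inv (fun i w => t (i, w)) c.1 c.2) ->
  forall n x, G n x -> G n (S x).
Proof.
move=> SM S_t; apply: G_ind => [n|n a x y hx hy||c n x hx].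
- by rewrite linear0.
- by rewrite linearP; apply: GZ.
- by rewrite SM.1.
rewrite SM.2 S_t; apply: GM hx; rewrite rct_degE.
apply: (graded_star_inv G0 GD GN GM G1) => i w.
by rewrite -(rct_degE (i, w)).
Qed.

(** The root gives every tree positive degree, so no product with a tree as a factor has degree
    0. *)
Lemma graded_connected x : G 0 x <-> exists a : k, x = a *: 1.
Proof.
split=> [hx|[a ->]]; last by rewrite -[_ *: _]addr0; apply: GZ.
suff H0 n y : G n y -> n = 0 -> exists a : k, y = a *: 1 by apply: H0 hx _.
move: n y => {x hx}; apply: G_ind => [n|n a x y hx hy||c n x hx] n0.
- by exists 0; rewrite scale0r.
- by have [b ->] := hx n0; have [b' ->] := hy n0; exists (a * b + b'); rewrite scalerA scalerDl.
- by exists 1; rewrite scale1r.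
by move/eqP: n0; rewrite rct_degE addn_eq0 addn1.
Qed.

End Grading.

End CircleTreeHopf.

(** * The algebra of circle trees *)

Section Homogeneous.
Context (k : fieldType) (m : nat).

Local Notation forest := (forest m).
Local Notation malg := {malg k[forest]}.
Implicit Types (f g : forest) (x y : malg).

Lemma forest_degEw f (D : {fset rct m}) : (finsupp f `<=` D)%fset ->
  forest_deg f = (\sum_(c <- D) f c * rct_deg c)%N.
Proof.
move=> fD; rewrite /forest_deg (big_fset_incl _ fD)//= => c _.
by rewrite -cmE_eq0 => /eqP->.
Qed.

Lemma forest_deg1 : forest_deg (mone : forest) = 0%N.
Proof. by rewrite /forest_deg mdom1 big_seq_fset0. Qed.

Lemma forest_degU (c : rct m) : forest_deg (ucm c) = rct_deg c.
Proof. by rewrite /forest_deg mdomU big_seq_fset1 cmUU mul1n. Qed.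

Lemma forest_degM f g : forest_deg (mmul f g) = (forest_deg f + forest_deg g)%N.
Proof.
have h1 : (finsupp f `<=` finsupp (mmul f g))%fset by rewrite mdomD fsubsetUl.
have h2 : (finsupp g `<=` finsupp (mmul f g))%fset by rewrite mdomD fsubsetUr.
rewrite (forest_degEw h1) (forest_degEw h2) -big_split /=.
by apply: eq_bigr => c _; rewrite cmM mulnDl.
Qed.

Lemma homogeneousP n x :
  @homogeneous k m n x <-> forall f, forest_deg f != n -> x@_f = 0.
Proof.
split=> h f; last by rewrite -mcoeff_neq0; apply: contraNeq => /h->.
by apply: contraNeq => xf; apply/eqP/h; rewrite -mcoeff_neq0.
Qed.

Lemma homogeneous_lin n (a : k) x y :
  @homogeneous k m n x -> @homogeneous k m n y -> @homogeneous k m n (a *: x + y).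
Proof.
move=> /homogeneousP hx /homogeneousP hy; apply/homogeneousP => f hf.
by rewrite mcoeffD mcoeffZ hx// hy// mulr0 addr0.
Qed.

Lemma homogeneous0 n : @homogeneous k m n (0 : malg).
Proof. by apply/homogeneousP => f _; rewrite mcoeff0. Qed.

Lemma homogeneousU f : @homogeneous k m (forest_deg f) (<< f >> : malg).
Proof.
apply/homogeneousP => g hg; rewrite mcoeffU1; case: eqP => // fg.
by rewrite fg eqxx in hg.
Qed.

Lemma homogeneousM p q x y :
  @homogeneous k m p x -> @homogeneous k m q y -> @homogeneous k m (p + q) (x * y : malg).
Proof.
move=> hx hy f /msuppM_le[u [v [hu hv ->]]].
by rewrite forest_degM (hx _ hu) (hy _ hv).
Qed.

Lemma homogeneous_span x : exists N (F : nat -> malg),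
  (forall n, @homogeneous k m n (F n)) /\ x = \sum_(0 <= n < N) F n.
Proof.
(* One more than the largest degree in the support, since the sum stops before its bound. *)
exists (\max_(f <- msupp x) forest_deg f).+1.
exists (fun n => \sum_(f <- msupp x | forest_deg f == n) << x@_f *g f >>); split=> [n|].
  elim/big_ind: _ => [|y z hy hz|f /eqP <-]; first exact: homogeneous0.
    by rewrite -[y]scale1r; apply: homogeneous_lin.
  rewrite monalgZU -[_ *: _]addr0; apply: homogeneous_lin; last exact: homogeneous0.
  exact: homogeneousU.
rewrite (exchange_big_dep xpredT)//= {1}[x]monalgE big_seq [RHS]big_seq.
apply: eq_bigr => f fx; rewrite (eq_bigl (fun i => i == forest_deg f)); last first.
  by move=> i; rewrite eq_sym.
rewrite -big_filter.
suff -> : [seq i <- index_iota 0 (\max_(f <- msupp x) forest_deg f).+1 | i == forest_deg f]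
    = [:: forest_deg f] by rewrite big_seq1.
by rewrite filter_pred1_uniq ?iota_uniq// mem_index_iota /= ltnS (@leq_bigmax_seq _ _ _ _ f).
Qed.

(** A forest can occur only in the component of its own degree, so coefficients are compared one
    forest at a time. *)
Lemma homogeneous_direct N (F : nat -> malg) : (forall n, @homogeneous k m n (F n)) ->
  \sum_(0 <= n < N) F n = 0 -> forall n, (n < N)%N -> F n = 0.
Proof.
move=> hF F0 n nN; apply/malgP => f; rewrite mcoeff0.
have [fn|fn] := eqVneq (forest_deg f) n; last by move/homogeneousP: (hF n); apply.
move/(congr1 (mcoeff f)): F0; rewrite mcoeff0 raddf_sum /= big_mkord.
rewrite (bigD1 (Ordinal nN)) //= big1 ?addr0// => i hi.
move/homogeneousP: (hF i); apply; rewrite fn; apply: contra hi => /eqP ni.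
by apply/eqP/val_inj.
Qed.

Lemma homogeneous_ind (P : nat -> Hcirc k m -> Prop) :
  (forall n, P n 0) -> (forall n a x y, P n x -> P n y -> P n (a *: x + y)) ->
  P 0 1 -> (forall c n x, P n x -> P (rct_deg c + n)%N (tree k c * x)) ->
  forall n x, homogeneous n x -> P n x.
Proof.
move=> P0 PZ P1 PM n x hx; rewrite [x]monalgE big_seq.
elim/big_ind: _ => [|y z hy hz|f fx]; first exact: P0.
  by rewrite -[y]scale1r; apply: PZ.
rewrite monalgZU -[X in P _ X]addr0; apply: PZ; last exact: P0.
rewrite -(hx _ fx); elim/forest_ind: f {fx} => [|c f hf].
  by rewrite forest_deg1; exact: P1.
rewrite forest_degM forest_degU; have := PM c _ _ hf.
by rewrite /tree -monalgUM.
Qed.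

Lemma homogeneous_graded : is_graded_algebra (@homogeneous k m).
Proof.
split.
- by move=> n; split; [exact: homogeneous0 | exact: homogeneous_lin].
- exact: homogeneous_span.
- exact: homogeneous_direct.
- have h1 := @homogeneousU mone; rewrite forest_deg1 in h1; exact: h1.
- exact: homogeneousM.
Qed.

Lemma counit_monoid : monoid_morphism (counit k m).
Proof. exact: (@linext_multext_monoid k m k^o). Qed.

(** The link between the combinatorial coproduct and series: it is the convolution of the two
    universal characters of the tensor square. *)
Lemma coproduct_treeE (c : rct m) : coproduct k m (tree k c) =
  star (fun i w => tree k (i, w) ⊗ 1) (fun i w => 1 ⊗ tree k (i, w)) c.1 c.2.
Proof.
rewrite coproduct_tree -(extraction_sum_star c (fun c => tree k c ⊗ 1) (fun c => 1 ⊗ tree k c)).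
rewrite /rct_coproduct; congr (_ + _); apply: eq_bigr => P _; apply: eq_bigr => n _.
exact/esym/tens_mul_prod.
Qed.

Lemma coproduct_monoid : monoid_morphism (coproduct k m).
Proof.
(* The extension lemma takes values in a nonzero algebra; multiplicativity of the counit shows that
   the tensor square is one. *)
exact: (@linext_multext_monoid k m (tensor_comAlg (tensor_neq0 counit_monoid))).
Qed.

Definition antipode : {linear Hcirc k m -> Hcirc k m} :=
  linext (multext (fun c => star_inv (fun i w => tree k (i, w)) c.1 c.2)).

Lemma antipode_monoid : monoid_morphism antipode.
Proof. exact: linext_multext_monoid. Qed.

Lemma antipode_tree c : antipode (tree k c) = star_inv (fun i w => tree k (i, w)) c.1 c.2.
Proof. exact: linext_multext_tree. Qed.

End Homogeneous.

Theorem theorem3p6 (k : fieldType) (hk : [pchar k] =i pred0)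
    (m : nat) (hm : (1 <= m)%N) :
  @is_connected_graded_commutative_Hopf_algebra k (Hcirc k m)
    (@homogeneous k m) (coproduct k m) (counit k m).
Proof.
have hI := @Hcirc_ind k m.
have hD := coproduct_monoid k m.
have hDt := @coproduct_treeE k m.
have hE := counit_monoid k m.
have hEt := @counit_tree k m.
have hG := homogeneous_graded k m.
have hGt (c : rct m) : homogeneous (rct_deg c) (tree k c).
  by rewrite -forest_degU; apply: homogeneousU.
have hGI := @homogeneous_ind k m.
split.
- exact: mulrC.
- by split=> //; exact: (coalgebra_circle_tree hI hD hDt hE hEt).
- exact: hG.
- exact: (Delta_graded hD hDt hG hGt hGI).
- exact: (eps_graded hE hEt hGI).
- exists (antipode k m).
    exact: (antipode_circle_tree hI hD hDt hE hEt (antipode_monoid k m) (@antipode_tree k m)).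
  exact: (antipode_graded hG hGt hGI (antipode_monoid k m) (@antipode_tree k m)).
- exact: (graded_connected hG hGI).
Qed.
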